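(* Let $\mathbf s=(s_n)_{n\ge0}$ be any sequence of positive integers and let $\mathcal A_{\mathbf s}$ be the weighted adjacency operator on the antitree with normalized edge weights $\mathbb A_{\mathbf s}$. Then the spectrum of $\mathcal A_{\mathbf s}$ is $[-2,2]$, and it is absolutely continuous except for a possibly embedded eigenvalue at $0$ of multiplicity $\sum_{n=0}^\infty(s_n-1)$ (which may be $0$, in which case there is no eigenvalue, or infinite).
   Context: For a sequence $\mathbf s=(s_n)_{n\ge0}$ of positive integers, $\mathbb A_{\mathbf s}$ is the weighted graph whose vertex set is the disjoint union of shells $S_n$, $n\ge 0$, with $\#S_n=s_n$; every vertex of $S_n$ is joined to every vertex of $S_{n+1}$ by an edge of weight $1/\sqrt{s_ns_{n+1}}$, and there are no other edges. $\mathcal A_{\mathbf s}$ acts on $\ell^2(\mathbb A_{\mathbf s})$ by $(\mathcal A_{\mathbf s}\psi)(x)=\sum_y a(x,y)\psi(y)$, where $a(x,y)$ is the weight of the edge between $x$ and $y$ ($0$ if there is none). *)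

(* Defs.v *)
From HB Require Import structures.
From mathcomp Require Import all_boot all_order all_algebra.
From mathcomp Require Import all_classical all_reals all_analysis.
From mathcomp Require Import complex.
Set Implicit Arguments.
Unset Strict Implicit.
Unset Printing Implicit Defensive.
Import Order.TTheory GRing.Theory Num.Theory.
Import numFieldNormedType.Exports.

Local Open Scope classical_set_scope.
Local Open Scope ring_scope.
Local Open Scope complex_scope.

Section EllTwo.
Context {R : realType} {V : choiceType}.
Implicit Types (f g : V -> R[i]) (W : set (V -> R[i])).

Definition sqmod (z : R[i]) : R := complex.Re z ^+ 2 + complex.Im z ^+ 2.

Definition sqsum f : \bar R := \esum_(x in [set: V]) (sqmod (f x))%:E.

(* Complex-valued functions are used as representatives of the elements of
   ell^2(V); membership is the predicate [ell2]. *)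
Definition ell2 : set (V -> R[i]) := [set f | (sqsum f < +oo)%E].

Definition ell2_norm f : R := Num.sqrt (fine (sqsum f)).

(* Unordered sums; meaningful for absolutely summable families only. *)
Definition rsum (u : V -> R) : R :=
  fine (\esum_(x in [set: V]) (u^\+ x)%:E
        - \esum_(x in [set: V]) (u^\- x)%:E)%E.

Definition csum (u : V -> R[i]) : R[i] :=
  rsum (fun x => complex.Re (u x)) +i* rsum (fun x => complex.Im (u x)).

Definition ell2_inner f g : R[i] := csum (fun x => (f x)^* * g x).

Definition ell2_orthocomp W : set (V -> R[i]) :=
  [set g | ell2 g /\ forall f, W f -> ell2_inner f g = 0].

Definition lin_indep (n : nat) (e : 'I_n -> V -> R[i]) : Prop :=
  forall c : 'I_n -> R[i],
    (forall x, \sum_(i < n) c i * e i x = 0) -> forall i, c i = 0.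

(* Dimension of a linear subspace, in {0, 1, 2, ..., +oo}: the supremum of the
   sizes of its linearly independent families. *)
Definition subspace_dim W : \bar R :=
  ereal_sup [set n%:R%:E | n in [set n : nat |
    exists e : 'I_n -> V -> R[i], (forall i, W (e i)) /\ lin_indep e]].

End EllTwo.

Section SpectralTheory.
Context {R : realType} {V : choiceType}.
(* Stands for a bounded linear operator of ell^2(V); only its values on [ell2]
   matter. *)
Variable A : (V -> R[i]) -> V -> R[i].

Definition shift_op (z : R[i]) (f : V -> R[i]) : V -> R[i] :=
  fun x => A f x - z * f x.

(* A - z is a bijection of ell^2(V) onto itself whose inverse is bounded. *)
Definition resolvent_set : set R[i] :=
  [set z | set_bij ell2 ell2 (shift_op z) /\
     exists M : R, forall f, ell2 f ->
       ell2_norm f <= M * ell2_norm (shift_op z f)].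

Definition op_spectrum : set R[i] := ~` resolvent_set.

Definition op_eigenspace (z : R[i]) : set (V -> R[i]) :=
  [set f | ell2 f /\ forall x, A f x = z * f x].

Definition op_eigenvalue (z : R[i]) : Prop :=
  exists2 f, op_eigenspace z f & exists x, f x != 0.

Definition poly_op (p : {poly R}) (f : V -> R[i]) : V -> R[i] :=
  fun x => \sum_(k < size p) (p`_k)%:C * iter k A f x.

(* For A bounded and self-adjoint, mu is the spectral measure of A at psi:
   the finite Borel measure on the (compact, real) spectrum of A such that
   <psi, p(A) psi> is the integral of p for all polynomials p. Polynomials are
   dense in the continuous functions on the spectrum, so this determines mu,
   and <psi, f(A) psi> is then the integral of f for continuous f. *)
Definition is_spectral_measure (psi : V -> R[i])
    (mu : {finite_measure set (measurableTypeR R) -> \bar R}) : Prop :=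
  mu [set x : R | ~ op_spectrum x%:C] = 0%E /\
  forall p : {poly R}, (\int[mu]_x p.[x])%:C = ell2_inner psi (poly_op p psi).

(* The vectors whose spectral measure is absolutely continuous with respect to
   Lebesgue measure. *)
Definition ac_subspace : set (V -> R[i]) :=
  [set psi | ell2 psi /\
     exists2 mu, is_spectral_measure psi mu & mu `<< @lebesgue_measure R].

End SpectralTheory.

Section Antitree.
Variables (R : realType) (s : nat -> nat).

(* The vertex [Tagged _ i] with tag n and i : 'I_(s n) is the i-th element of
   the shell S_n. *)
Definition antitree : Type := {n : nat & 'I_(s n)}.

HB.instance Definition _ := Choice.on antitree.

Definition weight (x y : antitree) : R :=
  if (tag y == (tag x).+1) || (tag x == (tag y).+1)
  then (Num.sqrt (s (tag x) * s (tag y))%N%:R)^-1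
  else 0.

(* The sum has finitely many nonzero terms since the shells are finite. *)
Definition adjacency_op (psi : antitree -> R[i]) : antitree -> R[i] :=
  fun x => \sum_(y \in [set: antitree]) (weight x y)%:C * psi y.

End Antitree.

(* Main.v *)
(* Averaging over shells, [f |-> s_n^(-1/2) \sum_(x in S_n) f x], is a coisometry Q
   of l^2 of the antitree onto l^2(nat), and the adjacency operator is Q^T J Q with
   J the free Jacobi matrix. Since J is injective, the kernel is that of Q, which has
   dimension \sum_n (s_n - 1), and on its orthocomplement the operator is a copy
   of J.

   If z = l + 1/l with |l| < 1, which is possible exactly when z is not in [-2, 2],
   then J - z = - l^-1 (1 - l S^T) (1 - l S), with S the shift, is invertible.
   For z in [-2, 2] the truncations of n |-> U_n(y / 2), y close to z, show that
   J - z is not bounded below.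

   U_n(J / 2) maps the first basis vector e_0 to e_n, and the U_n(x / 2) are
   orthogonal for the weight (4 - x^2)^(1/2) on [-2, 2]. Hence the spectral measure of
   J at u has, up to normalization, the density
   |\sum_n u_n U_n(x / 2)|^2 (4 - x^2)^(1/2). *)
From HB Require Import structures.
Require Import Defs.
From mathcomp Require Import all_boot all_order all_algebra.
From mathcomp Require Import all_classical all_reals all_analysis.
From mathcomp Require Import measurable_realfun complex.
From mathcomp Require Import ring lra zify.
Set Implicit Arguments.
Unset Strict Implicit.
Unset Printing Implicit Defensive.
Import Order.TTheory GRing.Theory Num.Theory.
Import numFieldNormedType.Exports.
Local Open Scope classical_set_scope.
Local Open Scope ring_scope.
Local Open Scope complex_scope.

(** * Chebyshev polynomials and the semicircle weight *)

(** A spectral measure is pinned down by its moments, so what has to be produced is a density $d$ on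
    $[-2,2]$ with $\int x^k d(x)\,dx = \langle u, J^k u\rangle$ for every $k$. The obstacle is that
    $\sum_n u_n U_n(x/2)$ has no evident pointwise limit for square-summable $u$: orthogonality
    gives convergence in mean square only. A limit function is therefore extracted along a rapidly
    growing subsequence. For finite sums, multiplication by $x$ is exactly $J$ and the moments
    follow from orthogonality; truncation at $N$ disturbs $J^k$ only near $N$, where the mass of $u$
    tends to $0$. As $J$ is real, a complex $u$ is treated through its real and imaginary parts.

    For the inclusion of $[-2,2]$ in the spectrum, the truncations are taken at $y = (1-d)z$ rather
    than at $z$: strictly inside the interval the values $U_n(y/2)$ stay bounded without decaying,
    so the squared norm of a truncation grows linearly in its length while its boundary error stays
    bounded. The shift $y - z$ is small enough to be absorbed. *)

(* The free Jacobi matrix, i.e. the adjacency operator of the half-line. *)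
Definition jacobi (V : nmodType) (u : nat -> V) (n : nat) : V :=
  u n.+1 + (if n is k.+1 then u k else 0).
Arguments jacobi {V}.

Section Chebyshev.
Variable K : comNzRingType.

(* [cheb n] is [U_n(X / 2)], with [U_n] the Chebyshev polynomial of the second
   kind. *)
Fixpoint cheb (n : nat) : {poly K} :=
  match n with
  | 0 => 1
  | n'.+1 => 'X * cheb n' - (match n' with 0 => 0 | k.+1 => cheb k end)
  end.

Lemma cheb1 : cheb 1 = 'X.
Proof. by rewrite /= subr0 mulr1. Qed.

Lemma chebSS n : cheb n.+2 = 'X * cheb n.+1 - cheb n.
Proof. by []. Qed.

Lemma jacobi_cheb n : jacobi cheb n = 'X * cheb n.
Proof. by rewrite /jacobi; case: n => [|n]; rewrite /= subrK. Qed.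

(** With $x = 2\cos\theta$ and $w = (4-x^2)^{1/2} = 2\sin\theta$, the product $w\,U_n(x/2)$ is
    $2\sin((n+1)\theta)$. The left side is $w$ times its derivative in $x$, so both sides are
    $-2(n+1)\cos((n+1)\theta)$. *)
Lemma cheb_deriv n :
  (4 - 'X ^+ 2) * (cheb n)^`() - 'X * cheb n =
  n.+1%:R * ((if n is k.+1 then cheb k else 0) - cheb n.+1).
Proof.
pose Q n := (if n is k.+1 then cheb k else 0).
pose P n := (4 - 'X ^+ 2) * (cheb n)^`() - 'X * cheb n =
  n.+1%:R * (Q n - cheb n.+1).
suff: P n /\ P n.+1 by case.
have rec m : cheb m.+1 = 'X * cheb m - Q m by case: m.
(* Here [e], [a], [b], [c], [d] stand for five consecutive polynomials, of indices $n-1$ to $n+3$,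
   and [k] for $n$. Abstracting them leaves an identity for [ring]. *)
have step (e a b c d k : {poly K}) : b = 'X * a - e -> c = 'X * b - a ->
    d = 'X * c - b -> (4 - 'X ^+ 2) * a^`() - 'X * a = (k + 1) * (e - b) ->
    (4 - 'X ^+ 2) * b^`() - 'X * b = (k + 2) * (a - c) ->
    (4 - 'X ^+ 2) * c^`() - 'X * c = (k + 3) * (b - d).
  move=> -> -> ->; rewrite !(derivB, derivM, derivX) => Ha Hb.
  transitivity ((4 - 'X ^+ 2) * ('X * a - e) +
    'X * ((4 - 'X^2) * (1 * a + 'X * a^`() - e^`()) - 'X * ('X * a - e)) +
    'X ^+ 2 * ('X * a - e) - ((4 - 'X ^+ 2) * a^`() - 'X * a) - 'X * a
    - 'X * ('X * ('X * a - e) - a)); first by ring.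
  by rewrite Ha Hb; ring.
elim: n => [|n [H1 H2]].
  by rewrite /P /Q /= derivC mulr1 subr0 derivX; split; ring.
split => //; move: (step _ _ _ _ _ n%:R (rec n) (rec n.+1) (rec n.+2)).
by rewrite natr1 -!natrD addn2 addn3 => /(_ H1 H2).
Qed.
End Chebyshev.
Arguments cheb : simpl never.

Section Semicircle.
Variable R : realType.
Notation mu := (@lebesgue_measure R).

(* Vanishes outside [[-2, 2]], because [Num.sqrt] is [0] on negative numbers. *)
Definition semicircle (x : R) : R := Num.sqrt (4 - x ^+ 2).

Definition sc_int (p : {poly R}) : R :=
  \int[mu]_(x in `[-2, 2]) (p.[x] * semicircle x).

Lemma semicircle_ge0 x : 0 <= semicircle x.
Proof. exact: sqrtr_ge0. Qed.

Lemma semicircle_eq0 x : x \notin `[-2, 2] -> semicircle x = 0.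
Proof.
rewrite in_itv /= => nx; apply: ler0_sqrtr; nra.
Qed.

Lemma continuous_semicircle : continuous semicircle.
Proof.
move=> x; apply: continuous_comp; last exact: sqrt_continuous.
by apply: continuousB; [exact: cst_continuous|exact: exprn_continuous].
Qed.

Lemma continuous_poly_semicircle (p : {poly R}) :
  continuous (fun x => p.[x] * semicircle x).
Proof.
by move=> x; apply: continuousM; [exact: continuous_horner|exact: continuous_semicircle].
Qed.

Lemma integrable_poly_semicircle (p : {poly R}) :
  mu.-integrable `[-2, 2] (EFin \o (fun x => p.[x] * semicircle x)).
Proof.
apply: continuous_compact_integrable; first exact: segment_compact.
by apply: continuous_subspaceT; exact: continuous_poly_semicircle.
Qed.

Lemma sc_intE p :
  (\int[mu]_(x in [set` `[(-2)%R, 2%R]]) (p.[x] * semicircle x)%:E = (sc_int p)%:E)%E.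
Proof.
rewrite /sc_int /Rintegral fineK //.
by have := integrable_fin_num _ (integrable_poly_semicircle p); apply; exact: measurable_itv.
Qed.

Lemma sc_intD p q : sc_int (p + q) = sc_int p + sc_int q.
Proof.
rewrite /sc_int -RintegralD //; try exact: integrable_poly_semicircle.
by apply: eq_Rintegral => x _; rewrite hornerD mulrDl.
Qed.

Lemma sc_intZ c p : sc_int (c *: p) = c * sc_int p.
Proof.
rewrite /sc_int -RintegralZl //; last exact: integrable_poly_semicircle.
by apply: eq_Rintegral => x _; rewrite hornerZ mulrA.
Qed.

(** The total mass, which is $2\pi$, serves as an unevaluated normalizing constant that must be
    invertible. The integrand is at least $1$ on $[0,1]$. *)
Lemma sc_int1_gt0 : 0 < sc_int 1.
Proof.
have := integrable_fin_num _ (integrable_poly_semicircle 1) => /(_ (measurable_itv _)) fin.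
pose D : set R := [set` `[-2, 2]]; pose E : set R := [set` `[0, 1]].
have mE : measurable (E : set (measurableTypeR R)) by exact: measurable_itv.
pose f (x : R) : \bar R := (1.[x] * semicircle x)%:E.
have f0 x : (0 <= f x)%E by rewrite lee_fin mulr_ge0 ?semicircle_ge0 // hornerC.
have mf (A : set (measurableTypeR R)) : measurable_fun A f.
  apply/measurable_EFinP; apply: measurable_funTS.
  by apply: continuous_measurable_fun; exact: continuous_poly_semicircle.
rewrite /sc_int /Rintegral fine_gt0 // ltey_eq fin andbT.
apply: (@lt_le_trans _ _ (\int[mu]_(x in E) cst 1%E x)%E).
  by rewrite /E integral_cst //= lebesgue_measure_itv /= lte_fin ltr01 mul1e sube0.
apply: (@le_trans _ _ (\int[mu]_(x in E) f x)%E).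
  apply: ge0_le_integral => //=.
  move=> x; rewrite /E /= in_itv /= /f lee_fin hornerC mul1r => x01.
  by rewrite -sqrtr1 ler_wsqrtr //; nra.
apply: ge0_subset_integral => //=.
by move=> x; rewrite /E /= !in_itv /= => x01; lra.
Qed.

(* The identity says that, on [(-2, 2)], the derivative of [Q] times the
   semicircle weight is [cheb R n.+1] times that weight. *)
Lemma cheb_primitive n (Q := n.+3%:R^-1 *: cheb R n.+2 - n.+1%:R^-1 *: cheb R n) :
  (4 - 'X ^+ 2) * Q^`() - 'X * Q = (4 - 'X ^+ 2) * cheb R n.+1.
Proof.
have H k : 'X * cheb R k = cheb R k.+1 + (if k is j.+1 then cheb R j else 0).
  by rewrite -jacobi_cheb.
rewrite /Q derivB !derivZ.
have D k : k.+1%:R^-1 *: ((4 - 'X ^+ 2) * (cheb R k)^`() - 'X * cheb R k) =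
  (if k is j.+1 then cheb R j else 0) - cheb R k.+1.
  by rewrite cheb_deriv mulr_natl -[X in _ *: X]scaler_nat scalerA mulVf ?scale1r ?pnatr_eq0.
transitivity (n.+3%:R^-1 *: ((4 - 'X ^+ 2) * (cheb R n.+2)^`() - 'X * cheb R n.+2)
 - n.+1%:R^-1 *: ((4 - 'X ^+ 2) * (cheb R n)^`() - 'X * cheb R n)).
  rewrite -!mul_polyC; ring.
rewrite !D.
transitivity (4 * cheb R n.+1 - 'X * ('X * cheb R n.+1)); last by ring.
have key (a b c d q : {poly R}) : 'X * b = c + a -> 'X * c = d + b ->
    'X * a = b + q -> b - d - (q - b) = 4 * b - 'X * ('X * b).
  by move=> ->; rewrite mulrDr => -> ->; ring.
exact: key (H n.+1) (H n.+2) (H n).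
Qed.

(** The primitive is a polynomial times the semicircle weight, hence vanishes at both endpoints. The
    weight is not differentiable there, so the fundamental theorem is applied with derivatives on
    the open interval and one-sided continuity at its ends. *)
Lemma sc_int_cheb n : sc_int (cheb R n.+1) = 0.
Proof.
have := cheb_primitive n; move: (cheb R n.+1) => C.
set Q := (X in let _ := X in _); move=> /= CQ; clearbody Q.
pose F x := Q.[x] * semicircle x.
have dF (x : R) : x \in `]-2, 2[ -> is_derive x (1 : R) F (C.[x] * semicircle x).
  rewrite in_itv /= => x2.
  have s0 : 0 < 4 - x ^+ 2 by nra.
  have ds : is_derive x (1 : R) (fun y : R => 4 - y ^+ 2) (- (2 * x)).
    rewrite (_ : (fun _ => _) = horner (4%:P - 'X^2)); last first.
      by apply/funext => y; rewrite !hornerE.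
    by apply: is_derive_eq; rewrite derivB derivC derivXn sub0r hornerN hornerMn hornerX mulr_natl.
  have dh := @is_derive1_comp _ Num.sqrt (fun y : R => 4 - y ^+ 2) x _ _ (is_derive1_sqrt s0) ds.
  have dFx := is_deriveM (is_derive_poly Q x) dh.
  apply: is_derive_eq dFx _.
  have h0 : Num.sqrt (4 - x ^+ 2) != 0 by rewrite gt_eqF // sqrtr_gt0.
  have hh : semicircle x ^+ 2 = 4 - x ^+ 2.
    by rewrite sqr_sqrtr // ltW.
  have := congr1 (horner^~ x) CQ.
  rewrite !(hornerD, hornerN, hornerM, hornerXn, hornerX, hornerMn, hornerC).
  rewrite /GRing.scale /= -[Num.sqrt _]/(semicircle x) in h0 *.
  move: (semicircle x) (Q.[x]) (Q^`().[x]) (C.[x]) h0 hh => s q q' c s0' hh E.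
  have {}E : s ^+ 2 * q' - x * q = s ^+ 2 * c by rewrite hh; lra.
  apply: (mulIf s0'); rewrite mulrDl [X in _ = X]mulrAC.
  rewrite [RHS](_ : _ = s ^+ 2 * c); last by ring.
  by rewrite -E; field.
have cF : continuous F by exact: continuous_poly_semicircle.
have bd : derivable_oo_LRcontinuous F (-2) 2.
  split.
  - by move=> x /dF[].
  - exact: cvg_at_right_filter (cF _).
  - exact: cvg_at_left_filter (cF _).
have FTC : (\int[mu]_(x in `[(- 2)%R, 2%R]) (C.[x] * semicircle x)%:E = (F 2)%:E - (F (-2))%:E)%E.
  apply: continuous_FTC2 bd _; first by lra.
  - by apply: continuous_subspaceT; exact: continuous_poly_semicircle.
  - by move=> x /dF dFx; rewrite derive1E; apply: derive_val.
rewrite /sc_int /Rintegral FTC /F /semicircle sqrrN.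
by rewrite (_ : 4 - 2 ^+ 2 = 0 :> R) ?sqrtr0 ?mulr0 ?subee //; ring.
Qed.

Lemma sc_int0 : sc_int 0 = 0.
Proof. by rewrite -(scale0r 0) sc_intZ mul0r. Qed.

Lemma sc_int_sum n (F : 'I_n -> {poly R}) :
  sc_int (\sum_(i < n) F i) = \sum_(i < n) sc_int (F i).
Proof.
exact: (big_morph sc_int sc_intD sc_int0).
Qed.

(** Multiplication by ['X] is symmetric under the integral: the induction on [m] moves one factor
    ['X] from the first polynomial to the second, where the recurrence expands it again. *)
Lemma sc_int_cheb_mul m n :
  sc_int (cheb R m * cheb R n) = (m == n)%:R * sc_int 1.
Proof.
elim/ltn_ind: m n => -[|[|m]] IH n.
- rewrite mul1r; case: n => [|n]; first by rewrite mul1r.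
  by rewrite sc_int_cheb mul0r.
- rewrite cheb1 -jacobi_cheb /jacobi sc_intD sc_int_cheb add0r.
  by case: n => [|[|n]]; rewrite ?sc_int_cheb /= ?mul0r ?mul1r // sc_int0.
- have -> : cheb R m.+2 * cheb R n =
      cheb R m.+1 * jacobi (cheb R) n + (-1) *: (cheb R m * cheb R n).
    by rewrite jacobi_cheb chebSS scaleN1r; ring.
  rewrite sc_intD sc_intZ IH // /jacobi mulrDr sc_intD IH // eqSS.
  rewrite mulN1r addrAC subrr add0r.
  case: n => [|n]; last by rewrite IH.
  by rewrite mulr0 sc_int0 mul0r.
Qed.
End Semicircle.

(** * Square-summable sequences and their Chebyshev expansions *)

Section SquareSums.
Variable R : realType.
Implicit Types (u v w : nat -> R).

Lemma sqsum_ge0 N (a : 'I_N -> R) : 0 <= \sum_(i < N) a i ^+ 2.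
Proof. by apply: sumr_ge0 => i _; exact: sqr_ge0. Qed.

Lemma sum_CauchySchwarz N (a b : 'I_N -> R) :
  (\sum_(i < N) a i * b i) ^+ 2 <=
  (\sum_(i < N) a i ^+ 2) * (\sum_(i < N) b i ^+ 2).
Proof.
elim: N a b => [|N IH] a b; first by rewrite !big_ord0 expr0n mulr0.
rewrite !big_ord_recr /=.
move: (IH (fun i => a (widen_ord (leqnSn N) i))
          (fun i => b (widen_ord (leqnSn N) i))) => /=.
have := sqsum_ge0 (fun i => a (widen_ord (leqnSn N) i)).
have := sqsum_ge0 (fun i => b (widen_ord (leqnSn N) i)).
move: (\sum_(_ < N) _ * _) (\sum_(_ < N) _ ^+ 2) (\sum_(_ < N) _ ^+ 2).
move: (a ord_max) (b ord_max) => x y S A B B0 A0 SAB.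
suff H : 2 * S * x * y <= A * y ^+ 2 + B * x ^+ 2 by nra.
have pos : 0 <= A * y ^+ 2 + B * x ^+ 2.
  by apply: addr_ge0; apply: mulr_ge0 => //; exact: sqr_ge0.
apply: le_trans (ler_norm _) _.
rewrite -ler_sqr ?nnegrE ?normr_ge0 // real_normK ?num_real //.
have -> : (2 * S * x * y) ^+ 2 = 4 * S ^+ 2 * (x * y) ^+ 2 by ring.
apply: (@le_trans _ _ (4 * (A * B) * (x * y) ^+ 2)).
  by rewrite ler_wpM2r ?sqr_ge0 // ler_wpM2l.
rewrite -subr_ge0; have := sqr_ge0 (A * y ^+ 2 - B * x ^+ 2); nra.
Qed.

Definition sqsummable u := exists C : R, forall N, \sum_(n < N) u n ^+ 2 <= C.

Lemma sqsummable_cvg u : sqsummable u ->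
  cvgn (fun N => \sum_(n < N) u n ^+ 2).
Proof.
move=> [C uC]; apply: nondecreasing_is_cvgn.
  apply/nondecreasing_seqP => n; by rewrite big_ord_recr /= lerDl sqr_ge0.
by exists C => _ [N _ <-].
Qed.

Lemma sqsummable_gap u k : sqsummable u ->
  (\sum_(n < N + k) u n ^+ 2 - \sum_(n < N) u n ^+ 2) @[N --> \oo] --> 0.
Proof.
pose S N := \sum_(n < N) u n ^+ 2.
move=> /sqsummable_cvg; rewrite -/S => cu.
have h : S (N + k)%N @[N --> \oo] --> limn S by rewrite (cvg_shiftn k S).
by have := cvgB h cu; rewrite subrr; exact.
Qed.

(** A finite form of $\|J\| \le 2$. The range on the right is longer by one because [jacobi u n]
    reads [u n.+1]. *)
Lemma jacobi_sqsum_le u N :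
  \sum_(n < N) jacobi u n ^+ 2 <= 4 * \sum_(n < N.+1) u n ^+ 2.
Proof.
have sq (x y : R) : (x + y) ^+ 2 <= 2 * x ^+ 2 + 2 * y ^+ 2.
  by rewrite -subr_ge0; have := sqr_ge0 (x - y); nra.
apply: (@le_trans _ _ (2 * (\sum_(n < N.+1) u n ^+ 2 - u 0 ^+ 2 + \sum_(n < N.-1) u n ^+ 2))).
  elim: N => [|[|N] IH].
  - by rewrite !big_ord0 big_ord1 subrr addr0 mulr0.
  - by rewrite !big_ord_recr !big_ord0 /= /jacobi; nra.
  - rewrite big_ord_recr [X in X - _]big_ord_recr [X in _ + X]big_ord_recr /=.
    have := sq (u N.+2) (u N); rewrite /jacobi; move: IH => /=; nra.
have : \sum_(n < N.-1) u n ^+ 2 <= \sum_(n < N.+1) u n ^+ 2.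
  case: N => [|N] /=; first by rewrite big_ord0 sumr_ge0 // => i _; exact: sqr_ge0.
  by rewrite !big_ord_recr /= -addrA lerDl addr_ge0 ?sqr_ge0.
have := sqr_ge0 (u 0); nra.
Qed.

Lemma iter_jacobi_sqsum_le u k N :
  \sum_(n < N) iter k jacobi u n ^+ 2 <= 4 ^+ k * \sum_(n < N + k) u n ^+ 2.
Proof.
elim: k N => [|k IH] N /=; first by rewrite expr0 mul1r addn0.
apply: le_trans (jacobi_sqsum_le _ _) _.
by rewrite exprS -mulrA ler_pM2l // addnS -addSn IH.
Qed.

Lemma iter_jacobiB u v k :
  iter k jacobi (fun n => u n - v n) =
  (fun n => iter k jacobi u n - iter k jacobi v n).
Proof.
elim: k => //= k ->; apply/funext => n; rewrite /jacobi.
by case: n => [|n]; [rewrite !addr0|ring].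
Qed.

Definition trunc N u n := if (n < N)%N then u n else 0.

Lemma sqsum_sub_trunc v N k :
  \sum_(n < N + k) (v n - trunc N v n) ^+ 2 =
  \sum_(n < N + k) v n ^+ 2 - \sum_(n < N) v n ^+ 2.
Proof.
rewrite !big_split_ord /= [RHS]addrC addKr big1 ?add0r => [|i _].
  by apply: eq_bigr => i _; rewrite /trunc ltnNge leq_addr subr0.
by rewrite /trunc ltn_ord subrr expr0n.
Qed.

(* Truncating [v] at [N] changes [iter k jacobi v] below [N] only within distance
   [k] of [N]. *)
Lemma jacobi_trunc_cvg u v k : sqsummable u -> sqsummable v ->
  (\sum_(n < N) u n * iter k jacobi v n -
   \sum_(n < N) u n * iter k jacobi (trunc N v) n) @[N --> \oo] --> 0.
Proof.
move=> [C uC] sv.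
pose D N := \sum_(n < N) u n * iter k jacobi v n -
   \sum_(n < N) u n * iter k jacobi (trunc N v) n.
pose g N := \sum_(n < N + k) v n ^+ 2 - \sum_(n < N) v n ^+ 2.
have Dg N : `|D N| <= Num.sqrt (C * 4 ^+ k * g N).
  rewrite -sqrtr_sqr ler_wsqrtr //.
  have -> : D N = \sum_(n < N) u n * iter k jacobi (fun n => v n - trunc N v n) n.
    rewrite iter_jacobiB /D -sumrB; apply: eq_bigr => i _; ring.
  apply: le_trans (sum_CauchySchwarz _ _) _.
  rewrite -mulrA ler_pM ?sqsum_ge0 //.
  apply: le_trans (iter_jacobi_sqsum_le _ _ _) _.
  by rewrite ler_pM2l ?exprn_gt0 // sqsum_sub_trunc.
apply/norm_cvg0P.
apply: (@squeeze_cvgr _ _ _ _ (cst 0) (fun N => Num.sqrt (C * 4 ^+ k * g N))).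
- by apply: nearW => N; rewrite normr_ge0 Dg.
- exact: cvg_cst.
- rewrite -[X in _ --> X]sqrtr0; apply: continuous_cvg; first exact: sqrt_continuous.
  by rewrite -(mulr0 (C * 4 ^+ k)); apply: cvgMr; exact: sqsummable_gap.
Qed.

Lemma sqsummableD u v : sqsummable u -> sqsummable v ->
  sqsummable (fun n => u n + v n).
Proof.
move=> [C uC] [E vE]; exists (2 * C + 2 * E) => N.
apply: (@le_trans _ _ (\sum_(n < N) (2 * u n ^+ 2 + 2 * v n ^+ 2))).
  apply: ler_sum => i _; rewrite -subr_ge0; have := sqr_ge0 (u i - v i); nra.
by rewrite big_split /= -!mulr_sumr; apply: lerD; rewrite ler_pM2l ?uC ?vE.
Qed.

Lemma sqsummableN u : sqsummable u -> sqsummable (fun n => - u n).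
Proof. by move=> [C uC]; exists C => N; under eq_bigr do rewrite sqrrN. Qed.

Lemma sqsummable_iter_jacobi u k : sqsummable u -> sqsummable (iter k jacobi u).
Proof.
move=> [C uC]; exists (4 ^+ k * C) => N.
by apply: le_trans (iter_jacobi_sqsum_le _ _ _) _; rewrite ler_pM2l ?exprn_gt0.
Qed.

(** By polarization, the products are differences of squares. *)
Lemma sqsummable_prod_cvg u v : sqsummable u -> sqsummable v ->
  cvgn (fun N => \sum_(n < N) u n * v n).
Proof.
move=> su sv.
have sD := sqsummable_cvg (sqsummableD su sv).
have sB := sqsummable_cvg (sqsummableD su (sqsummableN sv)).
pose A N := \sum_(n < N) (u n + v n) ^+ 2.
pose B N := \sum_(n < N) (u n - v n) ^+ 2.
have -> : (fun N => \sum_(n < N) u n * v n) = (fun N => 4^-1 * (A N - B N)).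
  apply/funext => N; rewrite -sumrB mulr_sumr; apply: eq_bigr => i _; by field.
have /cvg_ex[a ca] : cvgn A := sD.
have /cvg_ex[b cb] : cvgn B := sB.
by apply/cvg_ex; exists (4^-1 * (a - b)); apply: cvgMr; exact: cvgB ca cb.
Qed.

End SquareSums.

(** * Finite Chebyshev expansions and their moments *)

Section ChebyshevExpansion.
Variable R : realType.
Implicit Types (u v w : nat -> R).

Definition cheb_sum u N : {poly R} := \sum_(n < N) u n *: cheb R n.

Lemma cheb_sum_widen u N k : (forall n, (N <= n)%N -> u n = 0) ->
  cheb_sum u (N + k) = cheb_sum u N.
Proof.
move=> u0; rewrite /cheb_sum big_split_ord /= [X in _ + X]big1 ?addr0 // => i _.
by rewrite u0 ?scale0r // leq_addr.
Qed.

Lemma cheb_sum_trunc u N : cheb_sum (trunc N u) N = cheb_sum u N.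
Proof. by apply: eq_bigr => i _; rewrite /trunc ltn_ord. Qed.

Lemma cheb_sumB u v N :
  cheb_sum (fun n => u n - v n) N = cheb_sum u N - cheb_sum v N.
Proof.
by rewrite /cheb_sum -sumrB; apply: eq_bigr => i _; rewrite scalerBl.
Qed.

Lemma cheb_sum_sub_trunc u N k :
  cheb_sum (fun n => u n - trunc N u n) (N + k) =
  cheb_sum u (N + k) - cheb_sum u N.
Proof.
rewrite cheb_sumB -(cheb_sum_trunc u N) (@cheb_sum_widen (trunc N u)) // => n Nn.
by rewrite /trunc ltnNge Nn.
Qed.

(** Summation by parts for the symmetric difference operator [jacobi], with the discrete Wronskian
    of [w] and [cheb] as boundary term. *)
Lemma cheb_sum_Green w M :
  'X * cheb_sum w M.+1 - cheb_sum (jacobi w) M.+1 =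
  w M *: cheb R M.+1 - w M.+1 *: cheb R M.
Proof.
rewrite /cheb_sum; elim: M => [|M IH].
  rewrite !big_ord_recl !big_ord0 !addr0 /jacobi /= addr0 cheb1 /cheb.
  by rewrite -!mul_polyC; ring.
rewrite big_ord_recr [X in _ - X]big_ord_recr /=.
rewrite mulrDr opprD addrACA IH -scalerAr chebSS /jacobi -!mul_polyC !polyCD.
by ring.
Qed.

Lemma mulX_cheb_sum w M : (forall n, (M <= n)%N -> w n = 0) ->
  'X * cheb_sum w M = cheb_sum (jacobi w) M.+1.
Proof.
move=> w0; have := cheb_sum_Green w M.
rewrite -[M.+1]addn1 cheb_sum_widen // !w0 ?addn1 // !scale0r subrr.
by move/eqP; rewrite subr_eq0 => /eqP.
Qed.

Lemma iter_jacobi_supp w M k : (forall n, (M <= n)%N -> w n = 0) ->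
  forall n, (M + k <= n)%N -> iter k jacobi w n = 0.
Proof.
move=> w0; elim: k => [|k IH] n; first by rewrite addn0 => /w0.
rewrite addnS /= /jacobi; case: n => // n Mn.
by rewrite !IH ?addr0 // ltnW // ltnW.
Qed.

Lemma mulXn_cheb_sum w M k : (forall n, (M <= n)%N -> w n = 0) ->
  'X^k * cheb_sum w M = cheb_sum (iter k jacobi w) (M + k).
Proof.
move=> w0; elim: k => [|k IH]; first by rewrite expr0 mul1r addn0.
rewrite exprS -mulrA IH mulX_cheb_sum ?addnS //.
exact: iter_jacobi_supp.
Qed.

(** Parseval's identity. The second sum may be longer because multiplication by ['X^k] lengthens an
    expansion by [k]; the surplus terms are orthogonal to the first sum. *)
Lemma sc_int_cheb_sum_mul u v N k :
  sc_int (cheb_sum u N * cheb_sum v (N + k)) =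
  (\sum_(n < N) u n * v n) * sc_int 1.
Proof.
rewrite /cheb_sum mulr_suml sc_int_sum mulr_suml; apply: eq_bigr => i _.
rewrite mulr_sumr sc_int_sum (bigD1 (lshift k i)) //= big1 ?addr0 => [|j ji].
  by rewrite -scalerAl -scalerAr !sc_intZ sc_int_cheb_mul eqxx mul1r mulrA.
rewrite -scalerAl -scalerAr !sc_intZ sc_int_cheb_mul -(inj_eq val_inj) /= in ji *.
by rewrite eq_sym (negbTE ji) mul0r !mulr0.
Qed.

Lemma sc_int_cheb_sum_sqr u N :
  sc_int (cheb_sum u N ^+ 2) = (\sum_(n < N) u n ^+ 2) * sc_int 1.
Proof. by have := sc_int_cheb_sum_mul u u N 0; rewrite addn0. Qed.

Lemma sc_int_cheb_sum_Xn u v N k :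
  sc_int (cheb_sum u N * ('X^k * cheb_sum v N)) =
  (\sum_(n < N) u n * iter k jacobi (trunc N v) n) * sc_int 1.
Proof.
rewrite -(cheb_sum_trunc v) mulXn_cheb_sum ?sc_int_cheb_sum_mul // => n Nn.
by rewrite /trunc ltnNge Nn.
Qed.

End ChebyshevExpansion.

Section WeightedSums.
Variable R : realType.
Implicit Types (a : nat -> R).

(** Cauchy-Schwarz against the weights $2^{-(i+1)}$, whose sum stays below $1$; the induction peels
    off the first term with $(x+S)^2 \le 2x^2 + 2S^2$. *)
Lemma sqr_sum_le_weighted a n :
  (\sum_(i < n) a i) ^+ 2 <= \sum_(i < n) 2 ^+ i.+1 * a i ^+ 2.
Proof.
elim: n a => [|n IH] a; first by rewrite !big_ord0 expr0n.
rewrite !big_ord_recl /= expr1.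
have -> : \sum_(i < n) 2 ^+ (bump 0 i).+1 * a (bump 0 i) ^+ 2 =
    2 * \sum_(i < n) 2 ^+ i.+1 * a i.+1 ^+ 2.
  by rewrite mulr_sumr; apply: eq_bigr => i _; rewrite /bump leq0n add1n exprS mulrA.
have := IH (fun i => a i.+1); rewrite /bump /= -[\sum_(i < n) a (1 + i)%N]/(\sum_(i < n) a i.+1).
move: (\sum_(i < n) a i.+1) (\sum_(i < n) _ * _) (a 0%N) => S T x ST.
rewrite -subr_ge0; have := sqr_ge0 (x - S); nra.
Qed.

Lemma bounded_series_cvg (x y : nat -> R) (C : R) :
  (forall n, `|x n| <= y n) -> (forall N, \sum_(n < N) y n <= C) ->
  cvgn (fun N => \sum_(n < N) x n).
Proof.
move=> xy yC.
have -> : (fun n => \sum_(i < n) x i) = series x.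
  by apply/funext => n; rewrite /series /= big_mkord.
apply: normed_cvg.
have -> : [normed series x] = (fun n => \sum_(i < n) `|x i|).
  by apply/funext => n; rewrite -[LHS]/(\sum_(0 <= i < n) `|x i|) big_mkord.
apply: nondecreasing_is_cvgn.
  by apply/nondecreasing_seqP => n; rewrite big_ord_recr /= lerDl normr_ge0.
exists C => _ [n _ <-]; apply: le_trans (yC n).
by apply: ler_sum => i _; exact: xy.
Qed.

Lemma sum_geo (x : R) M : 0 <= x < 1 -> \sum_(k < M) x ^+ k <= (1 - x)^-1.
Proof.
move=> /andP[x0 x1]; have y0 : 0 < 1 - x by rewrite subr_gt0.
rewrite -(ler_pM2l y0) mulfV ?gt_eqF //.
suff -> : (1 - x) * \sum_(k < M) x ^+ k = 1 - x ^+ M by rewrite lerBlDr lerDl exprn_ge0.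
elim: M => [|M IH]; first by rewrite big_ord0 mulr0 expr0 subrr.
by rewrite big_ord_recr /= mulrDr IH exprS; ring.
Qed.

Lemma cvg_sqr (x : nat -> R) (L : R) : x M @[M --> \oo] --> L ->
  x M ^+ 2 @[M --> \oo] --> L ^+ 2.
Proof. by move=> xL; apply: (cvg_comp x (fun t => t ^+ 2) xL); exact: exprn_continuous. Qed.

(* [2 |a_i| <= 2^(i+1) a_i^2 + 2^-(i+1)]. *)
Lemma cvg_sum_weighted a C :
  (forall n, \sum_(i < n) 2 ^+ i.+1 * a i ^+ 2 <= C) ->
  cvgn (fun n => \sum_(i < n) a i).
Proof.
move=> aC.
apply: (@bounded_series_cvg _ (fun i => (2 ^+ i.+1 * a i ^+ 2 + (2 ^+ i.+1)^-1) / 2)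
  ((C + 1) / 2)) => n.
  rewrite ler_pdivlMr //.
  have t0 : 0 < 2 ^+ n.+1 :> R by rewrite exprn_gt0.
  rewrite -[a n ^+ 2]real_normK ?num_real //.
  move: (2 ^+ n.+1) (`|a n|) t0 => t x t0.
  rewrite -(ler_pM2r t0) mulrDl mulVf ?gt_eqF // -subr_ge0.
  have := sqr_ge0 (t * x - 1); nra.
have geo : \sum_(i < n) (2 ^+ i.+1)^-1 = 1 - (2 ^+ n)^-1 :> R.
  elim: n => [|m IH]; first by rewrite big_ord0 expr0 invr1 subrr.
  rewrite big_ord_recr /= IH exprS invfM.
  by rewrite -addrA; congr (_ + _); field; rewrite expf_neq0.
rewrite -mulr_suml ler_pM2r ?invr_gt0 // big_split /= geo; apply: lerD; first exact: aC.
by rewrite lerBlDr lerDl invr_ge0 exprn_ge0.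
Qed.
End WeightedSums.

(** * Square-integrable limits of Chebyshev expansions *)

Section SquareIntegrableExpansion.
Variable R : realType.
Notation mu := (@lebesgue_measure R).
Notation D := ([set` `[(-2)%R, 2%R]] : set (measurableTypeR R)).

(** Block masses of order $4^{-j}$ remain summable after multiplication by the weights $2^{j+1}$
    that control pointwise convergence. *)
Lemma sqsummable_subseq (u : nat -> R) : sqsummable u ->
  exists (N_ : nat -> nat) (K : R),
  [/\ 0 <= K, N_ 0 = 0, (forall j, N_ j <= N_ j.+1)%N, (forall j, j <= N_ j)%N &
   forall j, \sum_(n < N_ j.+1) u n ^+ 2 - \sum_(n < N_ j) u n ^+ 2
     <= K * (4 ^+ j)^-1].
Proof.
move=> su; pose S N := \sum_(n < N) u n ^+ 2.
have cS : cvgn S := sqsummable_cvg su.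
have ndS : {homo S : n m / (n <= m)%N >-> n <= m}.
  by apply/nondecreasing_seqP => n; rewrite /S big_ord_recr /= lerDl sqr_ge0.
pose T := limn S.
have ST N : S N <= T := nondecreasing_cvgn_le ndS cS N.
have tail j : exists n0, forall n, (n0 <= n)%N -> T - S n <= (4 ^+ j)^-1.
  have /cvgrPdist_le /(_ (4 ^+ j)^-1) := cS.
  rewrite invr_gt0 exprn_gt0 // => /(_ isT) [n0 _ H]; exists n0 => n /H.
  by rewrite ger0_norm // subr_ge0.
have [f fP] := choice tail.
pose N_ := fix N_ j := if j is j'.+1 then (maxn (N_ j') (f j)).+1 else 0%N.
have T0 : 0 <= T by apply: le_trans (ST 0%N); rewrite /S big_ord0.
(* The block starting at [N_ 0 = 0] is bounded only by the total mass [T], the later ones by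
   $4^{-j}$; [T + 1] covers both. *)
exists N_, (T + 1); split => //.
- by rewrite addr_ge0.
- by move=> j /=; rewrite ltnW // ltnS leq_maxl.
- by elim=> // j IH /=; rewrite ltnS (leq_trans IH) // leq_maxl.
- case=> [|j].
    rewrite expr0 invr1 mulr1 [X in _ - X]big_ord0 subr0.
    by apply: le_trans (ST _) _; rewrite lerDl.
  apply: (@le_trans _ _ (T - S (N_ j.+1))); first by rewrite lerB ?ST.

  apply: (@le_trans _ _ (4 ^+ j.+1)^-1).
    by apply: fP => /=; rewrite (leq_trans (leq_maxr (N_ j) _)).
  by rewrite ler_peMl ?invr_ge0 ?exprn_ge0 // lerDr.
Qed.

(* Riesz-Fischer: the partial sums converge almost everywhere along [N_], since
   the blocks [w j] between [N_ j] and [N_ j.+1] satisfy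
   [\sum_j 2^(j+1) ||w j||^2 < oo]; the same weighted series dominates the
   squares of the partial sums. The square root of the semicircle weight is
   absorbed into [f]. *)
Lemma sc_density_subseq (u : nat -> R) : sqsummable u ->
  exists (N_ : nat -> nat) (f : R -> R),
  [/\ (forall j, j <= N_ j)%N,
      measurable_fun (setT : set (measurableTypeR R)) f,
      (forall x : R, x \notin `[-2, 2] -> f x = 0),
      mu.-integrable D (fun x => (f x ^+ 2)%:E) &
      forall k, sc_int (cheb_sum u (N_ j) * ('X^k * cheb_sum u (N_ j)))
        @[j --> \oo] --> \int[mu]_(x in D) (x ^+ k * f x ^+ 2)].
Proof.
move=> su; have [N_ [K [K0 N0 Nle jN gap]]] := sqsummable_subseq su.
have mD : measurable D by exact: measurable_itv.
pose w j : {poly R} := cheb_sum u (N_ j.+1) - cheb_sum u (N_ j).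
pose r (x : R) : R := Num.sqrt (semicircle x).
pose psi j (x : R) : R := (w j).[x] * r x.
pose G (x : R) : \bar R := (\sum_(0 <= j <oo) (2 ^+ j.+1 * psi j x ^+ 2)%:E)%E.
have cpsi j : continuous (psi j).
  move=> x; apply: continuousM; first exact: continuous_horner.
  by apply: continuous_comp; [exact: continuous_semicircle|exact: sqrt_continuous].
have mpsi j : measurable_fun (setT : set (measurableTypeR R)) (psi j).
  exact: continuous_measurable_fun.
have wsc j : sc_int (w j ^+ 2) <= K * (4 ^+ j)^-1 * sc_int 1.
  rewrite /w -(subnKC (Nle j)) -cheb_sum_sub_trunc sc_int_cheb_sum_sqr.
  by rewrite ler_pM2r ?sc_int1_gt0 // sqsum_sub_trunc subnKC.
have psi_sq j x : psi j x ^+ 2 = (w j ^+ 2).[x] * semicircle x.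
  by rewrite exprMn sqr_sqrtr ?semicircle_ge0 // horner_exp.
have t0 j x : (0 <= (2 ^+ j.+1 * psi j x ^+ 2)%:E)%E.
  by rewrite lee_fin mulr_ge0 ?sqr_ge0 // exprn_ge0.
have G0 x : (0 <= G x)%E by apply: nneseries_ge0.
have mt j : measurable_fun (setT : set (measurableTypeR R))
    (fun x => (2 ^+ j.+1 * psi j x ^+ 2)%:E).
  apply/measurable_EFinP; apply: measurable_funM => //.
  exact: measurable_funX.
have mG : measurable_fun (setT : set (measurableTypeR R)) G.
  by apply: ge0_emeasurable_sum.
have iG : mu.-integrable D G.
  apply/integrableP; split; first exact: measurable_funTS.
  under eq_integral do rewrite gee0_abs //.
  rewrite integral_nneseries //; last by move=> j; exact: measurable_funTS.
  have int_t j : (\int[mu]_(x in D) (2 ^+ j.+1 * psi j x ^+ 2)%:E =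
      (2 ^+ j.+1 * sc_int (w j ^+ 2))%:E)%E.
    rewrite -sc_intZ -sc_intE; apply: eq_integral => x _.
    by rewrite psi_sq hornerZ mulrA.
  apply: (@le_lt_trans _ _ (4 * K * sc_int 1)%:E); last exact: ltry.
  apply: lime_le; first by apply: is_cvg_nneseries => j _ _; apply: integral_ge0.
  apply: nearW => n.
  rewrite big_mkord; under eq_bigr do rewrite int_t.
  rewrite sumEFin lee_fin.
  apply: (@le_trans _ _ (\sum_(j < n) 2 ^+ j.+1 * (4 ^+ j)^-1 * (K * sc_int 1))).
    apply: ler_sum => j _; rewrite -mulrA ler_pM2l ?exprn_gt0 //.
    by apply: le_trans (wsc j) _; rewrite mulrCA mulrA.
  rewrite -mulr_suml -mulrA ler_wpM2r //.
    by rewrite mulr_ge0 // ltW // sc_int1_gt0.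
  have -> : \sum_(j < n) 2 ^+ j.+1 * (4 ^+ j)^-1 = 4 - 4 * (2 ^+ n)^-1 :> R.
    elim: (n) => [|m IH]; first by rewrite big_ord0 expr0 invr1 mulr1 subrr.
    rewrite big_ord_recr /= IH !exprS.
    have -> : 4 ^+ m = 2 ^+ m * 2 ^+ m :> R by rewrite -exprMn; congr (_ ^+ _); ring.
    have p0 : 2 ^+ m != 0 :> R by rewrite expf_neq0.
    by field.
  by rewrite lerBlDr lerDl mulr_ge0 // invr_ge0 exprn_ge0.
pose A := [set x : R | (G x < +oo)%E].
have mA : measurable (A : set (measurableTypeR R)).
  by have := emeasurable_fun_infty_o measurableT mG +oo%E; rewrite setTI.
(* Cutting off outside [A], where the dominating series [G] diverges, makes the partial sums
   converge everywhere, so that their limit [f] is measurable. *)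
pose phi j (x : R) := \1_A x * \sum_(i < j) psi i x : R.
have mphi j : measurable_fun (setT : set (measurableTypeR R)) (phi j).
  apply: measurable_funM; first exact: measurable_indic.
  exact: measurable_sum.
pose f (x : R) : R := limn (phi^~ x).
have G_le x n : (G x < +oo)%E -> \sum_(i < n) 2 ^+ i.+1 * psi i x ^+ 2 <= fine (G x).
  move=> Gx; rewrite -lee_fin fineK ?ge0_fin_numE // -sumEFin.
  rewrite -(big_mkord predT (fun i => (2 ^+ i.+1 * psi i x ^+ 2)%:E)).
  exact: nneseries_lim_ge.
have cphi x : phi^~ x @ \oo --> f x.
  suff : cvgn (phi^~ x) by [].
  rewrite /phi indicE; case: (boolP (x \in A)) => [|_]; last first.
    by under eq_fun do rewrite mul0r; exact: is_cvg_cst.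
  rewrite inE => xA; under eq_fun do rewrite mul1r.
  exact: (@cvg_sum_weighted _ (psi^~ x) (fine (G x)) (fun n => G_le x n xA)).
have mf : measurable_fun (setT : set (measurableTypeR R)) f.
  exact: (@measurable_fun_cvg _ _ _ setT phi f mphi (fun x _ => cphi x)).
have phi_le j x : ((phi j x ^+ 2)%:E <= G x)%E.
  rewrite /phi indicE; case: (boolP (x \in A)) => [|_]; last first.
    by rewrite mul0r expr0n.
  rewrite inE => xA; rewrite mul1r.
  rewrite -(@fineK _ (G x)) ?ge0_fin_numE // lee_fin.
  exact: le_trans (sqr_sum_le_weighted (psi^~ x) j) (G_le x j xA).
have f0 x : x \notin `[-2, 2] -> f x = 0.
  move=> xD; rewrite /f (_ : phi^~ x = cst 0) ?lim_cst //.
  apply/funext => j; rewrite /phi big1 ?mulr0 // => i _.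
  by rewrite /psi /r semicircle_eq0 // sqrtr0 mulr0.
have sum_psi j x : \sum_(i < j) psi i x = (cheb_sum u (N_ j)).[x] * r x.
  rewrite -mulr_suml -horner_sum; congr (_.[x] * _).
  rewrite -(big_mkord predT w) telescope_sumr // N0 [X in _ - X]big_ord0.
  by rewrite subr0.
have mX k (g : measurableTypeR R -> R) : measurable_fun setT g ->
    measurable_fun D (fun x => (x ^+ k * g x ^+ 2)%:E).
  move=> mg; apply/measurable_EFinP; apply: measurable_funTS.
  apply: measurable_funM; last exact: measurable_funX.
  by apply: measurable_funX; exact: measurable_id.
have phi_ae k j : (\int[mu]_(x in D) (x ^+ k * phi j x ^+ 2)%:E =
    (sc_int (cheb_sum u (N_ j) * ('X^k * cheb_sum u (N_ j))))%:E)%E.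
  rewrite -sc_intE; apply: ae_eq_integral => //.
  - exact: mX.
  - apply/measurable_EFinP; apply: measurable_funTS.
    by apply: continuous_measurable_fun; exact: continuous_poly_semicircle.
  (* Since [G] is integrable, it is finite almost everywhere on [D], so the cut-off does not change
     the integrals. *)
  have [E [mE E0 sub]] := integrable_ae mD iG.
  exists E; split => // x /= Hx; apply: sub => /= HG; apply: Hx => xD.
  rewrite /phi indicE mem_set ?mul1r ?sum_psi.
    rewrite exprMn sqr_sqrtr ?semicircle_ge0 // !hornerE /=.
    congr (_%:E); ring.
  by rewrite /A /= -ge0_fin_numE // HG.
have dom k := @dominated_convergence _ _ _ mu D mD
  (fun j x => (x ^+ k * phi j x ^+ 2)%:E) (fun x => (x ^+ k * f x ^+ 2)%:E)
  (fun x => (2 ^+ k)%:E * G x)%E.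
have {}dom k : mu.-integrable D (fun x => (x ^+ k * f x ^+ 2)%:E) /\
   (\int[mu]_(x in D) (x ^+ k * phi j x ^+ 2)%:E)%E @[j --> \oo] -->
   (\int[mu]_(x in D) (x ^+ k * f x ^+ 2)%:E)%E.
  have [] := dom k; last by split.
  - by move=> n; exact: mX.
  - exact: mX.
  - apply: aeW => x _; apply: cvg_EFin; first by exact: nearW.
    apply: cvgMr; rewrite expr2.
    under [X in X @ _ --> _]eq_fun do rewrite expr2.
    by apply: cvgM; exact: cphi.
  - exact: integrableZl.
  - apply: aeW => x n; rewrite /= in_itv /= => xD.
    rewrite normrM EFinM; apply: lee_pmul => //.
      rewrite lee_fin normrX; apply: lerXn2r; rewrite ?nnegrE ?normr_ge0 //.
      by rewrite ler_norml.
    by rewrite ger0_norm ?sqr_ge0 // phi_le.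
exists N_, f; split => //.
  have [+ _] := dom 0%N; congr (_.-integrable _ _).
  by apply/funext => x; rewrite expr0 mul1r.
move=> k; have [ik] := dom k.
under [X in X @ _ --> _ -> _]eq_fun do rewrite phi_ae.
by rewrite -(fineK (integrable_fin_num mD ik)) => /fine_cvg.
Qed.

(** The full sums converge by square-summability, and truncating the second factor does not change
    their limit. Hence the limit can be evaluated along the subsequence for which the density is
    known. *)
Lemma sc_spectral_density (u : nat -> R) : sqsummable u ->
  exists d : measurableTypeR R -> R,
  [/\ measurable_fun setT d, (forall x, 0 <= d x),
      (forall x : R, x \notin `[-2, 2] -> d x = 0),
      (forall k, mu.-integrable setT (fun x => (x ^+ k * d x)%:E)) &
      forall k, \sum_(n < N) u n * iter k jacobi u n @[N --> \oo] -->
        \int[mu]_x (x ^+ k * d x)].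
Proof.
move=> su; have [N_ [f [jN mf f0 intf cf]]] := sc_density_subseq su.
have mD : measurable D by exact: measurable_itv.
have c0 : @sc_int R 1 != 0 by rewrite gt_eqF // sc_int1_gt0.
pose d (x : measurableTypeR R) : R := (@sc_int R 1)^-1 * f x ^+ 2.
have d0 x : 0 <= d x by rewrite mulr_ge0 ?sqr_ge0 // invr_ge0 ltW // sc_int1_gt0.
have dD (x : R) : x \notin `[-2, 2] -> d x = 0.
  by move=> /f0 fx; rewrite /d fx expr0n mulr0.
have md : measurable_fun setT d.
  by apply: measurable_funM => //; exact: measurable_funX.
have dE k : (fun x => (x ^+ k * d x)%:E) = (fun x => (x ^+ k * d x)%:E) \_ D.
  apply/funext => x; rewrite patchE; case: ifPn => // xD.
  by rewrite dD ?mulr0 //; apply: contra xD => xD; rewrite inE.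
have mxd k : measurable_fun (setT : set (measurableTypeR R)) (fun x => (x ^+ k * d x)%:E).
  by apply/measurable_EFinP; apply: measurable_funM.
have intD k : mu.-integrable D (fun x => (x ^+ k * d x)%:E).
  apply: (@le_integrable _ _ _ mu D mD _ (fun x => (2 ^+ k * (@sc_int R 1)^-1)%:E * (f x ^+ 2)%:E)%E).
  - exact: measurable_funTS.
  - move=> x; rewrite /= in_itv /= => xD; rewrite lee_fin !normrM.
    rewrite -mulrA; apply: ler_pM => //.
    rewrite normrX [`|2 ^+ k|]ger0_norm ?exprn_ge0 //.
    by apply: lerXn2r; rewrite ?nnegrE ?normr_ge0 // ler_norml.
  - exact: integrableZl.
have intT k : mu.-integrable setT (fun x => (x ^+ k * d x)%:E).
  rewrite dE.
  by have /(integrable_mkcond _ mD) := intD k.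
exists d; split => // k.
have /cvg_ex[L cL] := sqsummable_prod_cvg su (sqsummable_iter_jacobi k su).
suff -> : \int[mu]_x (x ^+ k * d x) = L by [].
pose b N := \sum_(n < N) u n * iter k jacobi (trunc N u) n.
have cb : b N @[N --> \oo] --> L.
  rewrite -[L]subr0 (_ : b = (fun N => \sum_(n < N) u n * iter k jacobi u n -
    (\sum_(n < N) u n * iter k jacobi u n - b N))).
    by apply: cvgB; [exact: cL|exact: jacobi_trunc_cvg].
  by apply/funext => N; rewrite subKr.
have cbj : b (N_ j) @[j --> \oo] --> L.
  apply: (cvg_comp N_ b _ cb).
  by move=> P [n _ nP]; exists n => // j nj; apply: nP; exact: leq_trans nj (jN j).
have := cf k; under [X in X @ _ --> _ -> _]eq_fun do rewrite sc_int_cheb_sum_Xn.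
move=> cI.
have cI2 : b (N_ j) * sc_int 1 @[j --> \oo] --> L * sc_int 1 by apply: cvgMl.
have E : \int[mu]_(x in D) (x ^+ k * f x ^+ 2) = L * sc_int 1.
  by rewrite -(cvg_lim (@norm_hausdorff _ _) cI); exact: cvg_lim.
have -> : \int[mu]_x (x ^+ k * d x) = \int[mu]_(x in D) (x ^+ k * d x).
  by rewrite /Rintegral [in RHS]integral_mkcond -dE.
have -> : \int[mu]_(x in D) (x ^+ k * d x) =
    \int[mu]_(x in D) ((sc_int 1)^-1 * (x ^+ k * f x ^+ 2)).
  by apply: eq_Rintegral => x _; rewrite /d; ring.
rewrite RintegralZl ?E //; first by rewrite mulrC mulfK.
have := integrableZl mD (@sc_int R 1) (intD k).
congr (_.-integrable _ _); apply/funext => x /=.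
by rewrite -EFinM /d mulrCA mulVKf.
Qed.
End SquareIntegrableExpansion.

(** * The antitree *)

Section ShellSums.
Variables (R : realType) (s : nat -> nat).
Notation V := (antitree s).

Definition vertex n (i : 'I_(s n)) : V := existT (fun n => 'I_(s n)) n i.

Definition ball_seq N : seq V :=
  [seq vertex i | n <- iota 0 N, i <- enum 'I_(s n)].

Lemma vertexE (x : V) : vertex (tagged x) = x. Proof. by case: x. Qed.

Lemma mem_ball_seq N (x : V) : (x \in ball_seq N) = (tag x < N)%N.
Proof.
apply/allpairsPdep/idP => [[n [i [nN _ ->]]]|xN].
  by rewrite mem_iota in nN.
exists (tag x), (tagged x); rewrite mem_iota mem_enum; split => //.
by rewrite vertexE.
Qed.

Lemma ball_seq_uniq N : uniq (ball_seq N).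
Proof.
apply: allpairs_uniq_dep; first exact: iota_uniq.
  by move=> n _; exact: enum_uniq.
by move=> [n i] [m j] _ _ /= E; exact: E.
Qed.

Lemma big_ball_seq (Z : nmodType) (F : V -> Z) N :
  \sum_(x <- ball_seq N) F x = \sum_(n < N) \sum_(i < s n) F (vertex i).
Proof.
rewrite big_allpairs_dep -[iota 0 N](_ : index_iota 0 N = _) ?big_mkord; last first.
  by rewrite /index_iota subn0.
by apply: eq_bigr => n _; rewrite big_enum.
Qed.

Lemma fsbig_ball (Z : nmodType) (F : V -> Z) N :
  (forall x : V, (N <= tag x)%N -> F x = 0) ->
  \sum_(x \in [set: V]) F x = \sum_(n < N) \sum_(i < s n) F (vertex i).
Proof.
move=> F0; rewrite -big_ball_seq [RHS]fsbig_seq ?ball_seq_uniq //.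
apply/esym/fsbig_widen => // x /= [_]; rewrite mem_ball_seq => /negP.
by rewrite -leqNgt => /F0.
Qed.

Definition ball_sum (g : V -> R) N := \sum_(n < N) \sum_(i < s n) g (vertex i).

Lemma ball_sum_esum (g : V -> R) N : (forall x, 0 <= g x) ->
  ((ball_sum g N)%:E <= \esum_(x in [set: V]) (g x)%:E)%E.
Proof.
move=> g0; rewrite /ball_sum -big_ball_seq -sumEFin.
rewrite fsbig_seq ?ball_seq_uniq //; apply: esum_ge.
by exists [set` ball_seq N] => //; split => //; exact: finite_seq.
Qed.

(** A finite set of vertices meets finitely many shells, so it lies in a ball. *)
Lemma esum_ball_le (g : V -> R) (C : R) : (forall x, 0 <= g x) ->
  (forall N, ball_sum g N <= C) -> (\esum_(x in [set: V]) (g x)%:E <= C%:E)%E.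
Proof.
move=> g0 gC; apply: ub_ereal_sup => _ [X [fX _] <-].
have [N XN] : exists N, X `<=` [set` ball_seq N].
  have /finite_seqP[r Xr] := fX.
  exists (\max_(x <- r) tag x).+1 => x; rewrite Xr /= mem_ball_seq => xr.
  by rewrite ltnS; apply: (@leq_bigmax_seq _ _ _ (fun x : V => tag x) x).
apply: (@le_trans _ _ (ball_sum g N)%:E); last by rewrite lee_fin.
rewrite /ball_sum -big_ball_seq -sumEFin [leRHS]fsbig_seq ?ball_seq_uniq //.
apply: lee_fsum_nneg_subset => //.
  by move=> x; rewrite !inE; exact: XN.
by move=> x _; rewrite lee_fin.
Qed.
End ShellSums.

Section EllTwoAntitree.
Variables (R : realType) (s : nat -> nat).
Notation V := (antitree s).
Implicit Types (f : V -> R[i]) (g u : V -> R).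

Lemma sqmod_ge0 (z : R[i]) : 0 <= sqmod z.
Proof. by rewrite addr_ge0 ?sqr_ge0. Qed.

Lemma ball_sum_nd g : (forall x, 0 <= g x) ->
  {homo ball_sum g : n m / (n <= m)%N >-> n <= m}.
Proof.
move=> g0; apply/nondecreasing_seqP => n.
by rewrite /ball_sum big_ord_recr /= lerDl sumr_ge0.
Qed.

Lemma esum_ball_lim g (C : R) : (forall x, 0 <= g x) ->
  (forall N, ball_sum g N <= C) ->
  ball_sum g N @[N --> \oo] --> fine (\esum_(x in [set: V]) (g x)%:E) /\
  (\esum_(x in [set: V]) (g x)%:E \is a fin_num)%E.
Proof.
move=> g0 gC.
have fin : (\esum_(x in [set: V]) (g x)%:E \is a fin_num)%E.
  rewrite ge0_fin_numE; first exact: le_lt_trans (esum_ball_le g0 gC) (ltry _).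
  by apply: esum_ge0 => x _; rewrite lee_fin.
split => //.
have nd := ball_sum_nd g0.
have cg : cvgn (ball_sum g).
  by apply: nondecreasing_is_cvgn => //; exists C => _ [N _ <-].
suff -> : fine (\esum_(x in [set: V]) (g x)%:E)%E = limn (ball_sum g) by [].
apply/eqP; rewrite eq_le; apply/andP; split; rewrite -lee_fin fineK //.
  by apply: esum_ball_le => // N; exact: nondecreasing_cvgn_le.
rewrite -(fineK fin) lee_fin; apply: limr_le => //; apply: nearW => N.
by rewrite -lee_fin fineK // ball_sum_esum.
Qed.

Lemma rsum_ball u (C : R) : (forall N, ball_sum (fun x => `|u x|) N <= C) ->
  ball_sum u N @[N --> \oo] --> rsum u.
Proof.
move=> uC.
have bd g : (forall x, 0 <= g x <= `|u x|) -> forall N, ball_sum g N <= C.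
  move=> gu N; apply: le_trans (uC N); apply: ler_sum => n _; apply: ler_sum => i _.
  by have /andP[] := gu (vertex i).
have p0 x : 0 <= u^\+ x <= `|u x|.
  by rewrite /funrpos le_max lexx orbT ge_max ler_norm normr_ge0.
have n0 x : 0 <= u^\- x <= `|u x|.
  by rewrite /funrneg le_max lexx orbT ge_max -normrN ler_norm normr_ge0.
have [cp fp] := esum_ball_lim (fun x => proj1 (andP (p0 x))) (bd _ p0).
have [cn fn] := esum_ball_lim (fun x => proj1 (andP (n0 x))) (bd _ n0).
rewrite /rsum fineB //.
rewrite (_ : ball_sum u = ball_sum u^\+ \- ball_sum u^\-); first exact: cvgB cp cn.
apply/funext => N; rewrite /ball_sum /= -sumrB; apply: eq_bigr => n _.
rewrite -sumrB; apply: eq_bigr => i _.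
by rewrite -[in LHS](funrposBneg u).
Qed.

Lemma rsum_finsupp u N : (forall x : V, (N <= tag x)%N -> u x = 0) ->
  rsum u = ball_sum u N.
Proof.
move=> u0.
have stab (w : V -> R) k : (forall x : V, (N <= tag x)%N -> w x = 0) ->
    ball_sum w (k + N) = ball_sum w N.
  move=> w0; rewrite addnC /ball_sum big_split_ord /= [X in _ + X]big1 ?addr0 // => i _.
  by rewrite big1 // => j _; rewrite w0 //= leq_addr.
have abs0 x : (N <= tag x)%N -> `|u x| = 0 by move=> /u0 ->; rewrite normr0.
have bd k : ball_sum (fun x => `|u x|) k <= ball_sum (fun x => `|u x|) N.
  rewrite -(stab _ k abs0); apply: ball_sum_nd => [x|]; first exact: normr_ge0.
  exact: leq_addr.
have := rsum_ball bd; rewrite -(cvg_shiftn N) => h.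
have : ball_sum u (k + N)%N @[k --> \oo] --> ball_sum u N.
  by under eq_fun do rewrite stab //; exact: cvg_cst.
by move/(cvg_lim (@norm_hausdorff _ _)) => <-; rewrite -(cvg_lim (@norm_hausdorff _ _) h).
Qed.

Lemma ell2P f : ell2 f <->
  exists C : R, forall N, ball_sum (sqmod \o f) N <= C.
Proof.
rewrite /ell2 /sqsum /=; split => [fin|[C fC]].
  exists (fine (\esum_(x in [set: V]) (sqmod (f x))%:E)) => N.
  rewrite -lee_fin fineK; first exact: (ball_sum_esum _ (fun x => sqmod_ge0 (f x))).
  by rewrite ge0_fin_numE // esum_ge0 // => x _; rewrite lee_fin sqmod_ge0.
by apply: le_lt_trans (esum_ball_le (fun x => sqmod_ge0 (f x)) fC) (ltry _).
Qed.

Lemma ell2_norm_ge0 f : 0 <= ell2_norm f. Proof. exact: sqrtr_ge0. Qed.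

Lemma ell2_norm_le f (C : R) : 0 <= C ->
  (forall N, ball_sum (sqmod \o f) N <= C ^+ 2) -> ell2_norm f <= C.
Proof.
move=> C0 fC; rewrite /ell2_norm -(ger0_norm C0) -sqrtr_sqr ler_wsqrtr //.
have [_ fin] := esum_ball_lim (fun x => sqmod_ge0 (f x)) fC.
by rewrite -lee_fin fineK // esum_ball_le // => x; exact: sqmod_ge0.
Qed.

Lemma ball_sum_le_norm f N : ell2 f ->
  ball_sum (sqmod \o f) N <= ell2_norm f ^+ 2.
Proof.
move=> /ell2P[C fC].
have [_ fin] := esum_ball_lim (fun x => sqmod_ge0 (f x)) fC.
rewrite sqr_sqrtr; last by rewrite fine_ge0 // esum_ge0 // => x _; rewrite lee_fin sqmod_ge0.
by rewrite -lee_fin fineK //; exact: (ball_sum_esum _ (fun x => sqmod_ge0 (f x))).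
Qed.

End EllTwoAntitree.

Section RadialReduction.
Variables (R : realType) (s : nat -> nat).
Hypothesis s_gt0 : forall n, (0 < s n)%N.
Notation V := (antitree s).
Notation A := (@adjacency_op R s).
Implicit Types (f : V -> R[i]) (u : nat -> R[i]).

(* [radial] is the coisometry onto [l^2(nat)] that averages over the shells, and
   [spread] is its adjoint. *)
Definition radial f n : R[i] :=
  ((Num.sqrt (s n)%:R)^-1)%:C * \sum_(i < s n) f (vertex i).

Definition spread u : V -> R[i] :=
  fun x => ((Num.sqrt (s (tag x))%:R)^-1)%:C * u (tag x).

Lemma sqrt_s_neq0 n : Num.sqrt (s n)%:R != 0 :> R.
Proof. by rewrite gt_eqF // sqrtr_gt0 ltr0n. Qed.

Lemma sum_spread_const n (c : R[i]) :
  \sum_(i < s n) ((Num.sqrt (s n)%:R)^-1)%:C * c = (Num.sqrt (s n)%:R)%:C * c.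
Proof.
rewrite sumr_const card_ord -[LHS]mulr_natl mulrA -(rmorph_nat (real_complex R)).
rewrite -rmorphM /=; congr (_%:C * _).
by rewrite -[X in X / _](sqr_sqrtr (ler0n R (s n))) expr2 mulfK // sqrt_s_neq0.
Qed.

Lemma radialK u : radial (spread u) = u.
Proof.
apply/funext => n; rewrite /radial /spread /= sum_spread_const mulrA.
by rewrite -rmorphM /= mulVf ?mul1r // sqrt_s_neq0.
Qed.

(** The normalized weight is a product of one factor per endpoint: the factor at [x] goes into
    [spread], the other one into [radial]. *)
Lemma adjacency_shell f (x : V) n :
  \sum_(i < s n) (weight R x (vertex i))%:C * f (vertex i) =
  if (n == (tag x).+1) || (tag x == n.+1)
  then ((Num.sqrt (s (tag x))%:R)^-1)%:C * radial f n else 0.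
Proof.
rewrite /weight /=; case: ifP => _; last by rewrite big1 // => i _; rewrite mul0r.
rewrite -mulr_sumr /radial mulrA -rmorphM /=; congr (_%:C * _).
by rewrite natrM sqrtrM ?ler0n // invfM.
Qed.

Lemma adjacencyE f : A f = spread (jacobi (radial f)).
Proof.
apply/funext => x; rewrite /adjacency_op (@fsbig_ball s _ _ (tag x).+2); last first.
  move=> y xy; rewrite /weight; case: ifP; last by rewrite mul0r.
  by case/orP=> /eqP E; move: xy; rewrite E ?ltnn // ltnNge => /negP[]; lia.
under eq_bigr do rewrite adjacency_shell.
rewrite big_ord_recr /= eqxx /= addrC /spread /jacobi mulrDr; congr (_ + _).
case: (tag x) => [|m]; first by rewrite big_ord1 /= mulr0.
rewrite !big_ord_recr /= !eqxx orbT.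
rewrite big1 => [|i _]; first by rewrite (ltn_eqF (ltnSn _)) /= add0r addr0.
by case: ifP => // /orP[] /eqP; have := ltn_ord i; lia.
Qed.

Lemma adjacency_spread u : A (spread u) = spread (jacobi u).
Proof. by rewrite adjacencyE radialK. Qed.

Lemma iter_adjacency_spread u k : iter k A (spread u) = spread (iter k jacobi u).
Proof. by elim: k => //= k ->; rewrite adjacency_spread. Qed.

Lemma sqmodM (a b : R[i]) : sqmod (a * b) = sqmod a * sqmod b.
Proof. by case: a => a1 a2; case: b => b1 b2; rewrite /sqmod /=; ring. Qed.

Lemma sqmod_real (a : R) : sqmod a%:C = a ^+ 2.
Proof. by rewrite /sqmod /= expr0n addr0. Qed.

Lemma sqmod_eq0 (z : R[i]) : sqmod z = 0 -> z = 0.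
Proof.
move=> /eqP; rewrite /sqmod paddr_eq0 ?sqr_ge0 // !sqrf_eq0.
by case: z => a b /= /andP[/eqP -> /eqP ->].
Qed.

Lemma sqmod_spread u n : \sum_(i < s n) sqmod (spread u (vertex i)) = sqmod (u n).
Proof.
rewrite /spread /= sumr_const card_ord sqmodM sqmod_real -[LHS]mulr_natl mulrA.
by rewrite exprVn sqr_sqrtr ?ler0n // mulfV ?mul1r // pnatr_eq0 -lt0n.
Qed.

Lemma ball_sum_spread u N :
  ball_sum (sqmod \o spread u) N = \sum_(n < N) sqmod (u n).
Proof. by apply: eq_bigr => n _; exact: sqmod_spread. Qed.

Lemma sqmod_radial_le f n : sqmod (radial f n) <= \sum_(i < s n) sqmod (f (vertex i)).
Proof.
rewrite /radial sqmodM sqmod_real exprVn sqr_sqrtr ?ler0n //.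
rewrite mulrC ler_pdivrMr ?ltr0n // /sqmod !raddf_sum big_split /= mulrDl.
have CS (g : 'I_(s n) -> R) :
    (\sum_(i < s n) g i) ^+ 2 <= (\sum_(i < s n) g i ^+ 2) * (s n)%:R.
  have := sum_CauchySchwarz g (fun=> 1).
  under eq_bigr do rewrite mulr1.
  by under [X in _ * X]eq_bigr do rewrite expr1n; rewrite sumr_const card_ord.
by apply: lerD; exact: CS.
Qed.

Definition csqsummable u :=
  exists C : R, forall N, \sum_(n < N) sqmod (u n) <= C.

Lemma ell2_spread u : ell2 (spread u) <-> csqsummable u.
Proof.
rewrite ell2P; split => -[C uC]; exists C => N; last by rewrite ball_sum_spread.
by rewrite -ball_sum_spread.
Qed.

Lemma csqsummable_radial f : ell2 f -> csqsummable (radial f).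
Proof.
move=> /ell2P[C fC]; exists C => N; apply: le_trans (fC N).
by apply: ler_sum => n _; exact: sqmod_radial_le.
Qed.
End RadialReduction.

(** * The spectrum *)

Section ComplexJacobi.
Variable R : realType.
Implicit Types (u v a b : nat -> R[i]) (z l : R[i]).

Lemma sqmodD_le z1 z2 : sqmod (z1 + z2) <= 2 * sqmod z1 + 2 * sqmod z2.
Proof.
case: z1 => a1 b1; case: z2 => a2 b2; rewrite /sqmod /= -subr_ge0.
have := sqr_ge0 (a1 - a2); have := sqr_ge0 (b1 - b2); nra.
Qed.

Lemma sqmodN z : sqmod (- z) = sqmod z.
Proof. by case: z => x y; rewrite /sqmod /= !sqrrN. Qed.

Lemma sqmod_sum_nd u : {homo (fun N => \sum_(n < N) sqmod (u n)) : n m / (n <= m)%N >-> n <= m}.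
Proof.
by apply/nondecreasing_seqP => n; rewrite big_ord_recr /= lerDl sqmod_ge0.
Qed.

(* [u_(n+1)^2 + u_n^2 - z u_(n+1) u_n] does not depend on [n], but tends to [0]
   along a square-summable solution. *)
Lemma jacobi_eigen0 u z : csqsummable u ->
  (forall n, jacobi u n = z * u n) -> forall n, u n = 0.
Proof.
move=> [C uC] Ju.
have rec n : u n.+2 = z * u n.+1 - u n by rewrite -Ju /jacobi addrK.
have u1 : u 1 = z * u 0 by rewrite -Ju /jacobi addr0.
have E n : u n.+1 ^+ 2 + u n ^+ 2 - z * u n.+1 * u n = u 0 ^+ 2.
  elim: n => [|n <-]; first by rewrite u1; ring.
  by rewrite rec; ring.
pose K := 8 * (1 + sqmod z).
have K0 : 0 < K by rewrite mulr_gt0 // ltr_wpDr ?sqmod_ge0.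
(* The invariant is quadratic in [u], so it controls the square of [sqmod (u 0)]; [K] is a crude
   constant making the bound hold after taking roots. *)
have lb n : sqmod (u 0) <= K * (sqmod (u n.+1) + sqmod (u n)).
  rewrite -ler_sqr ?nnegrE ?sqmod_ge0 //; last first.
    by apply: mulr_ge0; [exact: ltW|rewrite addr_ge0 ?sqmod_ge0].
  rewrite expr2 -sqmodM -expr2 -(E n).
  apply: le_trans (sqmodD_le _ _) _; rewrite sqmodN.
  have := sqmodD_le (u n.+1 ^+ 2) (u n ^+ 2); rewrite !sqmodM.
  have := sqmod_ge0 (u n.+1); have := sqmod_ge0 (u n); have := sqmod_ge0 z.
  rewrite /K; move: (sqmod (_ + _)) (sqmod (u n.+1)) (sqmod (u n)) (sqmod z) => e x y t t0 y0 x0 H.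
  have xy := mulr_ge0 x0 y0; have txy := mulr_ge0 t0 xy.
  have tt := sqr_ge0 t; have := mulr_ge0 (sqr_ge0 t) xy.
  have := mulr_ge0 t0 (sqr_ge0 x); have := mulr_ge0 t0 (sqr_ge0 y).
  have := mulr_ge0 tt (sqr_ge0 x); have := mulr_ge0 tt (sqr_ge0 y).
  have := sqr_ge0 x; have := sqr_ge0 y.
  nra.
have u0 : u 0 = 0.
  apply: sqmod_eq0; apply/eqP; rewrite eq_le sqmod_ge0 andbT leNgt; apply/negP => d0.
  (* Summing the lower bound replaces the passage to the limit: the left side grows linearly, the
     right side is bounded. *)
  have sumlb N : N%:R * sqmod (u 0) <= K * (C + C).
    apply: (@le_trans _ _ (\sum_(n < N) K * (sqmod (u n.+1) + sqmod (u n)))).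
      rewrite -[N in N%:R]card_ord mulr_natl -sumr_const.
      by apply: ler_sum => i _; exact: lb.
    rewrite -mulr_sumr ler_pM2l // big_split /=; apply: lerD; last exact: uC.
    apply: le_trans (uC N.+1); rewrite big_ord_recl /=.
    by rewrite lerDr sqmod_ge0.
  have := sumlb (Num.bound (K * (C + C) / sqmod (u 0))).
  rewrite leNgt -ltr_pdivrMr // => /negP; apply.
  have C0 : 0 <= C by have := uC 0; rewrite big_ord0.
  apply: archi_boundP; apply: divr_ge0; last exact: sqmod_ge0.
  by apply: mulr_ge0; [exact: ltW|exact: addr_ge0].
have two n : u n = 0 /\ u n.+1 = 0.
  elim: n => [|n [IH1 IH2]]; first by rewrite u1 u0 mulr0.
  by rewrite rec IH1 IH2 mulr0 subr0.
by move=> n; have [] := two n.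
Qed.

(* The two roots of [X^2 - z X + 1] have product [1]; if both are on the unit
   circle they are conjugate and [z] is twice their real part. *)
Lemma joukowski_root z :
  (forall x : R, x \in `[-2, 2] -> z <> x%:C) ->
  exists l, [/\ l != 0, sqmod l < 1 & z = l + l^-1].
Proof.
move=> zx.
pose w := sqrtc (z ^+ 2 - 4); pose l := (z + w) / 2; pose l' := (z - w) / 2.
have ww : w ^+ 2 = z ^+ 2 - 4 by rewrite sqr_sqrtc.
have ll' : l * l' = 1.
  have -> : l * l' = (z ^+ 2 - w ^+ 2) / 4 by rewrite /l /l'; field.
  by rewrite ww subKr divff // (_ : 4 = 4%:R) // pnatr_eq0.
have zl : z = l + l' by rewrite /l /l'; field.
have mm : sqmod l * sqmod l' = 1 by rewrite -sqmodM ll' sqmod_real expr1n.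
have inv x y : x * y = 1 -> x != 0 /\ x^-1 = y :> R[i].
  move=> xy; have x0 : x != 0.
    by apply/eqP => x0; move: xy; rewrite x0 mul0r => /eqP; rewrite eq_sym oner_eq0.
  by split => //; apply: (mulfI x0); rewrite divff.
have [l1|l1|l1] := ltgtP (sqmod l) 1.
- by exists l; have [l0 lV] := inv _ _ ll'; rewrite lV.
- exists l'; have [l0 lV] := inv l' l (etrans (mulrC _ _) ll'); rewrite lV addrC.
  split => //; rewrite -(ltr_pM2l (lt_trans ltr01 l1)) mm mulr1 //.
- exfalso; move: l1 ll' zl; clearbody l l'; case: l {mm} => a b; case: l' => c d.
  rewrite /sqmod /= => l1 ll' zl.
  have [E1 E2] : a * c - b * d = 1 /\ a * d + b * c = 0.
    by move: ll' => /eqP; rewrite eq_complex /= => /andP[/eqP -> /eqP ->].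
  have Ec : c = a.
    transitivity (a * (a * c - b * d) + b * (a * d + b * c)); last by rewrite E1 E2; ring.
    by rewrite -[LHS]mul1r -l1; ring.
  have Ed : d = - b.
    transitivity (a * (a * d + b * c) - b * (a * c - b * d)); last by rewrite E1 E2; ring.
    by rewrite -[LHS]mul1r -l1; ring.
  apply: (zx (a + a)); first by rewrite in_itv /=; apply/andP; split; nra.
  by rewrite zl Ec Ed; apply/eqP; rewrite eq_complex /= subrr !eqxx.
Qed.
End ComplexJacobi.

(** * The resolvent of the free Jacobi matrix *)

Section JacobiResolvent.
Variable R : realType.
Variable l : R[i].
Hypotheses (l_neq0 : l != 0) (l_lt1 : sqmod l < 1).
Implicit Types (u v a b : nat -> R[i]).
Let r : R := Num.sqrt (sqmod l).

Let r_gt0 : 0 < r.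
Proof.
rewrite sqrtr_gt0 lt_def sqmod_ge0 andbT; apply/eqP => /sqmod_eq0 l0.
by have := l_neq0; rewrite l0 eqxx.
Qed.

Let r2 : r ^+ 2 = sqmod l. Proof. by rewrite sqr_sqrtr // sqmod_ge0. Qed.

Let r_lt1 : r < 1.
Proof. by have := r_gt0; have := l_lt1; rewrite -r2; nra. Qed.

(** Convexity of the square with weights $1-r$ and $r$ gives the coefficients $(1-r)^{-1}$ and
    $r^{-1}$; since $|l|^2 = r^2$, the latter turns into the contraction factor $r$. *)
Lemma sqmod_contraction (x y : R[i]) :
  sqmod (x + l * y) <= (1 - r)^-1 * sqmod x + r * sqmod y.
Proof.
have H : sqmod (x + l * y) <= (1 - r)^-1 * sqmod x + r^-1 * sqmod (l * y).
  have rr : 0 < 1 - r by rewrite subr_gt0.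
  move: (l * y) => w; case: x => x1 x2; case: w => w1 w2; rewrite /sqmod /=.
  have key (p q : R) : (p + q) ^+ 2 <= (1 - r)^-1 * p ^+ 2 + r^-1 * q ^+ 2.
    rewrite -(ler_pM2l (mulr_gt0 rr r_gt0)).
    have -> : (1 - r) * r * ((1 - r)^-1 * p ^+ 2 + r^-1 * q ^+ 2) =
        r * p ^+ 2 + (1 - r) * q ^+ 2.
      by field; rewrite !gt_eqF.
    rewrite -subr_ge0; have := sqr_ge0 (r * p - (1 - r) * q); nra.
  have := key x1 w1; have := key x2 w2; lra.
apply: le_trans H _; rewrite lerD2l sqmodM -r2 mulrA expr2 mulrA mulVf ?mul1r //.
by rewrite gt_eqF.
Qed.

(** The square of $\sum_k r^k$, hence a bound for the squared norm of the Neumann series. It is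
    chosen so that [K * C] is a fixed point of the estimate in [sqmod_contraction], which lets
    inductions close. *)
Let K : R := (1 - r)^-1 ^+ 2.

Let K_ge0 : 0 <= K. Proof. exact: sqr_ge0. Qed.

Let K_fix (C : R) : (1 - r)^-1 * C + r * (K * C) = K * C.
Proof. by rewrite /K; field; rewrite gt_eqF // subr_gt0. Qed.

(* Inverts [1 - l S], where [S] is the right shift. *)
Lemma forward_solve a (C : R) : (forall N, \sum_(n < N) sqmod (a n) <= C) ->
  exists b, (forall n, b n = a n + l * (if n is k.+1 then b k else 0)) /\
    forall N, \sum_(n < N) sqmod (b n) <= K * C.
Proof.
move=> aC.
pose b := fix b n := a n + l * (if n is k.+1 then b k else 0).
exists b; split; first by case.
have C0 : 0 <= C by have := aC 0; rewrite big_ord0.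
suff H N : \sum_(n < N.+1) sqmod (b n) <=
    (1 - r)^-1 * \sum_(n < N.+1) sqmod (a n) + r * \sum_(n < N) sqmod (b n).
  elim=> [|N IH]; first by rewrite big_ord0 mulr_ge0.
  apply: le_trans (H N) _; rewrite -(K_fix C) lerD //.
    by rewrite ler_pM2l // invr_gt0 subr_gt0.
  by rewrite ler_pM2l.
elim: N => [|N IH].
  rewrite !big_ord_recr !big_ord0 /= !add0r.
  by apply: le_trans (sqmod_contraction _ _) _; rewrite /sqmod /= !expr0n addr0.
rewrite big_ord_recr [X in _ * X + _]big_ord_recr [X in _ + _ * X]big_ord_recr /=.
have := sqmod_contraction (a N.+1) (b N); move: IH => /=; nra.
Qed.

(* Inverts the adjoint shift factor [1 - l S^T] by the Neumann series
   [a n = \sum_k l ^+ k * u (n + k)], whose partial sums obey a bound that the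
   contraction step preserves. *)
Lemma backward_solve u (C : R) : (forall N, \sum_(n < N) sqmod (u n) <= C) ->
  exists a, (forall n, a n = u n + l * a n.+1) /\
    forall N, \sum_(n < N) sqmod (a n) <= K * C.
Proof.
move=> uC.
have C0 : 0 <= C by have := uC 0; rewrite big_ord0.
pose t n k := l ^+ k * u (n + k)%N.
pose p M n := \sum_(k < M) t n k.
have pS M n : p M.+1 n = u n + l * p M n.+1.
  rewrite /p big_ord_recl /t /= expr0 mul1r addn0; congr (_ + _).
  rewrite mulr_sumr; apply: eq_bigr => k _.
  by rewrite /bump /= add1n exprS addnS addSn mulrA.
have pC M N : \sum_(n < N) sqmod (p M n) <= K * C.
  elim: M N => [|M IH] N.
    rewrite big1 => [|n _]; first exact: mulr_ge0 K_ge0 C0.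
    by rewrite /p big_ord0 /sqmod /= expr0n addr0.
  rewrite -(K_fix C).
  apply: (@le_trans _ _ (\sum_(n < N) ((1 - r)^-1 * sqmod (u n) + r * sqmod (p M n.+1)))).
    by apply: ler_sum => n _; rewrite pS; exact: sqmod_contraction.
  rewrite big_split /= -!mulr_sumr; apply: lerD.
    by apply: ler_wpM2l; [rewrite invr_ge0 subr_ge0 ltW|exact: uC].
  rewrite ler_pM2l //; apply: le_trans (IH N.+1).
  by rewrite big_ord_recl /= lerDr sqmod_ge0.
(* Each component of the series converges absolutely because $|l^k u_{n+k}| \le |l|^{2k} +
   |u_{n+k}|^2$. *)
have tbd n M : \sum_(k < M) (sqmod l ^+ k + sqmod (u (n + k)%N)) <= (1 - sqmod l)^-1 + C.
  rewrite big_split /= lerD //; first by rewrite sum_geo // sqmod_ge0.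
  apply: le_trans (uC (n + M)%N); rewrite big_split_ord /= lerDr.
  by apply: sumr_ge0 => i _; exact: sqmod_ge0.
have sqmodX k : sqmod (l ^+ k) = sqmod l ^+ k.
  by elim: k => [|k IH]; rewrite ?sqmod_real ?expr1n // !exprS sqmodM IH.
have tRe n k : `|complex.Re (t n k)| <= sqmod l ^+ k + sqmod (u (n + k)%N).
  rewrite /t -sqmodX; case: (l ^+ k) (u (n + k)%N) => x y [x' y'].
  rewrite /sqmod /= ler_norml.
  have := sqr_ge0 (x - x'); have := sqr_ge0 (x + x').
  have := sqr_ge0 (y - y'); have := sqr_ge0 (y + y').
  by move=> *; apply/andP; split; nra.
have tIm n k : `|complex.Im (t n k)| <= sqmod l ^+ k + sqmod (u (n + k)%N).
  rewrite /t -sqmodX; case: (l ^+ k) (u (n + k)%N) => x y [x' y'].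
  rewrite /sqmod /= ler_norml.
  have := sqr_ge0 (x - y'); have := sqr_ge0 (x + y').
  have := sqr_ge0 (y - x'); have := sqr_ge0 (y + x').
  by move=> *; apply/andP; split; nra.
have cRe n : cvgn (fun M => complex.Re (p M n)).
  rewrite (_ : (fun M => _) = (fun M => \sum_(k < M) complex.Re (t n k))).
    exact: bounded_series_cvg (tRe n) (tbd n).
  by apply/funext => M; rewrite /p raddf_sum.
have cIm n : cvgn (fun M => complex.Im (p M n)).
  rewrite (_ : (fun M => _) = (fun M => \sum_(k < M) complex.Im (t n k))).
    exact: bounded_series_cvg (tIm n) (tbd n).
  by apply/funext => M; rewrite /p raddf_sum.
pose a n := limn (fun M => complex.Re (p M n)) +i* limn (fun M => complex.Im (p M n)).
have cR k : complex.Re (p M k) @[M --> \oo] --> complex.Re (a k) by exact: cRe.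
have cI k : complex.Im (p M k) @[M --> \oo] --> complex.Im (a k) by exact: cIm.
exists a; split => [n|N].
  have cRS : complex.Re (p M.+1 n) @[M --> \oo] --> complex.Re (a n).
    by have := cR n; rewrite -(cvg_shiftS (fun M => complex.Re (p M n))).
  have cIS : complex.Im (p M.+1 n) @[M --> \oo] --> complex.Im (a n).
    by have := cI n; rewrite -(cvg_shiftS (fun M => complex.Im (p M n))).
  have lR : complex.Re (p M.+1 n) @[M --> \oo] --> complex.Re (u n) +
      (complex.Re l * complex.Re (a n.+1) - complex.Im l * complex.Im (a n.+1)).
    rewrite (_ : (fun M => complex.Re (p M.+1 n)) = (fun M => complex.Re (u n) +
      (complex.Re l * complex.Re (p M n.+1) - complex.Im l * complex.Im (p M n.+1)))).
      by apply: cvgD; [exact: cvg_cst|apply: cvgB; apply: cvgMr].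
    by apply/funext => M; rewrite pS; case: (l) (u n) (p M n.+1) => ? ? [? ?] [? ?].
  have lI : complex.Im (p M.+1 n) @[M --> \oo] --> complex.Im (u n) +
      (complex.Re l * complex.Im (a n.+1) + complex.Im l * complex.Re (a n.+1)).
    rewrite (_ : (fun M => complex.Im (p M.+1 n)) = (fun M => complex.Im (u n) +
      (complex.Re l * complex.Im (p M n.+1) + complex.Im l * complex.Re (p M n.+1)))).
      by apply: cvgD; [exact: cvg_cst|apply: cvgD; apply: cvgMr].
    by apply/funext => M; rewrite pS; case: (l) (u n) (p M n.+1) => ? ? [? ?] [? ?].
  have := cvg_unique _ lR cRS; have := cvg_unique _ lI cIS.
  move=> /(_ (@norm_hausdorff _ _)) EI /(_ (@norm_hausdorff _ _)) ER.
  move: EI ER; case: (l) (u n) (a n) (a n.+1) => ? ? [? ?] [? ?] [? ?] /= EI ER.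
  by apply/eqP; rewrite eq_complex /= ER EI !eqxx.
have cS : \sum_(n < N) sqmod (p M n) @[M --> \oo] --> \sum_(n < N) sqmod (a n).
  elim: (N) => [|m IH].
    by rewrite big_ord0; under eq_fun do rewrite big_ord0; exact: cvg_cst.
  rewrite big_ord_recr /=; under eq_fun do rewrite big_ord_recr /=.
  exact: cvgD IH (cvgD (cvg_sqr (cR m)) (cvg_sqr (cI m))).
rewrite -(cvg_lim (@norm_hausdorff _ _) cS).
by apply: limr_le; [apply/cvg_ex; exists (\sum_(n < N) sqmod (a n))|exact: nearW].
Qed.

(* With [J = S + S^T] one has [(1 - l S^T) (1 - l S) = - l (J - (l + l^-1))]. *)
Lemma jacobi_solve : exists2 K' : R, 0 <= K' & forall u (C : R),
  (forall N, \sum_(n < N) sqmod (u n) <= C) ->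
  exists v, (forall n, jacobi v n - (l + l^-1) * v n = u n) /\
    forall N, \sum_(n < N) sqmod (v n) <= K' * C.
Proof.
exists (sqmod l * (K * K)); first exact: mulr_ge0 (sqmod_ge0 l) (mulr_ge0 K_ge0 K_ge0).
move=> u C uC; have [a [au aC]] := backward_solve uC.
have [b [ba bC]] := forward_solve aC.
exists (fun n => - l * b n); split => [n|N]; last first.
  under eq_bigr do rewrite sqmodM sqmodN.
  rewrite -mulr_sumr -(mulrA (sqmod l)) -(mulrA K).
  by apply: ler_wpM2l; [exact: sqmod_ge0|exact: bC].
have aE m : a m = b m - l * (if m is k.+1 then b k else 0).
  by rewrite {1}(ba m) addrK.
have -> : u n = a n - l * a n.+1 by rewrite {1}(au n) addrK.
rewrite (aE n.+1) (aE n) /jacobi.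
have -> : (if n is k.+1 then - l * b k else 0) = - l * (if n is k.+1 then b k else 0).
  by case: (n); rewrite ?mulr0.
move: (b n) (b n.+1) (if n is k.+1 then b k else 0) => x y q.
have -> : (l + l^-1) * (- l * x) = - (l * l * x) - (l^-1 * l) * x by ring.
by rewrite mulVf //; ring.
Qed.
End JacobiResolvent.

Section Spectrum.
Variables (R : realType) (s : nat -> nat).
Hypothesis s_gt0 : forall n, (0 < s n)%N.
Notation V := (antitree s).
Notation A := (@adjacency_op R s).
Implicit Types (f g : V -> R[i]) (u v : nat -> R[i]).

Lemma csqsummable_jacobi u : csqsummable u -> csqsummable (jacobi u).
Proof.
move=> [C uC]; exists (2 * C + 2 * C) => N.
apply: (@le_trans _ _ (2 * \sum_(n < N) sqmod (u n.+1) +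
    2 * \sum_(n < N) sqmod (if (n : nat) is k.+1 then u k else 0))).
  rewrite !mulr_sumr -big_split /=; apply: ler_sum => n _; exact: sqmodD_le.
apply: lerD; rewrite ler_pM2l //.
  by apply: le_trans (uC N.+1); rewrite big_ord_recl /= lerDr sqmod_ge0.
case: N => [|N]; first by rewrite big_ord0; have := uC 0; rewrite big_ord0.
by rewrite big_ord_recl /= sqmod_real expr0n add0r; exact: uC.
Qed.

Lemma ball_sumD_le f g (c : R[i]) N :
  ball_sum (sqmod \o (fun x => f x + c * g x)) N <=
  2 * ball_sum (sqmod \o f) N + 2 * sqmod c * ball_sum (sqmod \o g) N.
Proof.
rewrite /ball_sum !mulr_sumr -big_split /=; apply: ler_sum => n _.
rewrite !mulr_sumr -big_split /=; apply: ler_sum => i _.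
by apply: le_trans (sqmodD_le _ _) _; rewrite sqmodM mulrA.
Qed.

Lemma ell2_lincomb f g (c : R[i]) : ell2 f -> ell2 g ->
  ell2 (fun x => f x + c * g x).
Proof.
move=> /ell2P[C fC] /ell2P[D gD]; apply/ell2P; exists (2 * C + 2 * sqmod c * D) => N.
apply: le_trans (ball_sumD_le _ _ _ _) _; apply: lerD; first by rewrite ler_pM2l.
by apply: ler_wpM2l => //; rewrite mulr_ge0 // sqmod_ge0.
Qed.

Lemma radial_lincomb f g (c : R[i]) n :
  radial (fun x => f x + c * g x) n = radial f n + c * radial g n.
Proof. by rewrite /radial big_split /= -mulr_sumr mulrDr mulrCA. Qed.

Lemma jacobi_lincomb u v (c : R[i]) n :
  jacobi (fun n => u n + c * v n) n = jacobi u n + c * jacobi v n.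
Proof. by rewrite /jacobi; case: n => [|n]; rewrite ?addr0 //; ring. Qed.

Lemma adjacency_lincomb f g (c : R[i]) x :
  A (fun x => f x + c * g x) x = A f x + c * A g x.
Proof.
rewrite !adjacencyE /spread.
have -> : radial (fun x => f x + c * g x) = fun n => radial f n + c * radial g n.
  by apply/funext => n; exact: radial_lincomb.
by rewrite jacobi_lincomb mulrDr mulrCA.
Qed.

Lemma adjacency_ell2 f : ell2 f -> ell2 (A f).
Proof.
move=> f2; rewrite adjacencyE; apply/ell2_spread => //.
by apply: csqsummable_jacobi; exact: csqsummable_radial.
Qed.

Lemma shift_op_ell2 z f : ell2 f -> ell2 (shift_op A z f).
Proof.
move=> f2; have := ell2_lincomb (- z) (adjacency_ell2 f2) f2.
by congr ell2; apply/funext => x; rewrite /shift_op mulNr.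
Qed.

(** Averaging the eigenvalue equation over shells makes [radial f] a square-summable eigenvector of
    [jacobi], which has none but zero. *)
Lemma eigen_radial z f : ell2 f -> (forall x, A f x = z * f x) ->
  forall n, radial f n = 0.
Proof.
move=> f2 Af; apply: (@jacobi_eigen0 _ _ z) (csqsummable_radial s_gt0 f2) _ => n.
have <- : radial (A f) n = jacobi (radial f) n by rewrite adjacencyE radialK.
rewrite /radial; under eq_bigr do rewrite Af.
by rewrite -mulr_sumr mulrCA.
Qed.

Lemma adjacency_radial0 f : (forall n, radial f n = 0) -> forall x, A f x = 0.
Proof.
move=> f0 x; rewrite adjacencyE /spread /jacobi f0 add0r.
by case: (tag x) => [|n]; rewrite ?f0 mulr0.
Qed.

Lemma eigen_nonzero z f : z != 0 -> ell2 f -> (forall x, A f x = z * f x) ->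
  forall x, f x = 0.
Proof.
move=> z0 f2 Af x; apply: (mulfI z0).
by rewrite -Af mulr0 adjacency_radial0 //; exact: eigen_radial Af.
Qed.

Lemma shift_op_inj z f g : z != 0 -> ell2 f -> ell2 g ->
  shift_op A z f = shift_op A z g -> f = g.
Proof.
move=> z0 f2 g2 E; apply/funext => x; apply/eqP; rewrite -subr_eq0 -mulN1r; apply/eqP.
apply: (eigen_nonzero z0 (ell2_lincomb (-1) f2 g2)) => {}x.
have := congr1 (@^~ x) E; rewrite /shift_op /= adjacency_lincomb => E'.
rewrite mulrDr; apply/eqP; rewrite -subr_eq0; apply/eqP.
transitivity ((A f x - z * f x) - (A g x - z * g x)); first by ring.
by rewrite E' subrr.
Qed.

(** The radial part of [f] is handled by the resolvent of [jacobi]; on the remainder [h], which has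
    zero shell sums, $A - z$ is multiplication by $-z$. *)
Lemma shift_op_solve z : z != 0 ->
  (exists l, [/\ l != 0, sqmod l < 1 & z = l + l^-1]) ->
  exists2 M : R, 0 <= M & forall f (C : R), 0 <= C ->
    (forall N, ball_sum (sqmod \o f) N <= C) ->
    exists2 g, shift_op A z g = f & forall N, ball_sum (sqmod \o g) N <= M * C.
Proof.
move=> z0 [l [l0 l1 zl]]; have [K K0 HK] := jacobi_solve l0 l1.
pose q := sqmod (- z^-1); have q0 : 0 <= q by exact: sqmod_ge0.
(* Each use of [ball_sumD_le] costs a factor $2$; the $4$ bounds [h], a difference of two functions
   whose ball sums are at most [C]. *)
exists (2 * K + 2 * q * 4); first by rewrite addr_ge0 ?mulr_ge0.
move=> f C C0 fC; pose u := radial f.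
have uC N : \sum_(n < N) sqmod (u n) <= C.
  by apply: le_trans (fC N); apply: ler_sum => n _; exact: sqmod_radial_le.
have [v [Jv vC]] := HK u C uC.
pose h x := f x + (-1) * spread u x.
pose g x := spread v x + (- z^-1) * h x.
have rg : radial g = v.
  apply/funext => n; rewrite radial_lincomb radial_lincomb !radialK //.
  by rewrite mulN1r subrr mulr0 addr0.
exists g.
  apply/funext => x; rewrite /shift_op adjacencyE rg /g /h /spread.
  have := Jv (tag x); rewrite -zl => Jvx.
  have -> : jacobi v (tag x) = u (tag x) + z * v (tag x) by rewrite -Jvx subrK.
  move: (_%:C) (u (tag x)) (v (tag x)) (f x) => k a b c.
  by field.
move=> N; apply: le_trans (ball_sumD_le _ _ _ _) _; rewrite ball_sum_spread // [leRHS]mulrDl.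
apply: lerD; first by rewrite -mulrA ler_pM2l.
rewrite -!mulrA ler_pM2l //; apply: ler_wpM2l => //.
apply: le_trans (ball_sumD_le _ _ _ _) _; rewrite ball_sum_spread // sqmodN sqmod_real.
have := fC N; have := uC N; rewrite expr1n; lra.
Qed.

Lemma resolvent_off_interval z :
  (forall x : R, x \in `[-2, 2] -> z <> x%:C) -> resolvent_set A z.
Proof.
move=> zx.
have z0 : z != 0.
  by apply/eqP => z0; apply: (zx 0) => //; rewrite in_itv /=; apply/andP; split; lra.
have [M M0 HM] := shift_op_solve z0 (joukowski_root zx).
have ball_sq f : ell2 f -> forall N, ball_sum (sqmod \o f) N <= ell2_norm f ^+ 2.
  by move=> f2 N; exact: ball_sum_le_norm.
split.
  split.
  - by move=> f; exact: shift_op_ell2.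
  - by move=> f g; rewrite !inE => f2 g2; exact: shift_op_inj.
  - move=> f f2; have [g gf gM] := HM f _ (sqr_ge0 _) (ball_sq f f2).
    by exists g => //; apply/ell2P; exists (M * ell2_norm f ^+ 2).
exists (Num.sqrt M) => f f2.
have F2 := shift_op_ell2 z f2.
have [g gf gM] := HM _ _ (sqr_ge0 _) (ball_sq _ F2).
have g2 : ell2 g by apply/ell2P; exists (M * ell2_norm (shift_op A z f) ^+ 2).
have fg := shift_op_inj z0 g2 f2 gf.
apply: ell2_norm_le; first by rewrite mulr_ge0 ?sqrtr_ge0 ?ell2_norm_ge0.
by move=> N; rewrite exprMn sqr_sqrtr // -[in X in X <= _]fg.
Qed.
End Spectrum.

(** * Approximate eigenvectors on $[-2,2]$ *)

Section IntervalInSpectrum.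
Variables (R : realType) (s : nat -> nat).
Hypothesis s_gt0 : forall n, (0 < s n)%N.
Notation A := (@adjacency_op R s).

Lemma cheb_invariant (y : R) n (v := fun n => (cheb R n).[y]) :
  v n.+1 ^+ 2 + v n ^+ 2 - y * v n.+1 * v n = 1.
Proof.
elim: n => [|n <-]; first by rewrite /v cheb1 hornerX hornerC; ring.
by rewrite /v chebSS hornerD hornerN hornerM hornerX; ring.
Qed.

(** The conserved form $a^2 + b^2 - yab$ has eigenvalues $1 \pm y/2$, which lie between $d$ and
    $2-d$. The first inequality bounds truncation errors, the second forces linear growth of the
    norm. *)
Lemma cheb_consecutive_bounds (y d : R) n (v := fun n => (cheb R n).[y]) :
  0 < d <= 1 -> `|y| <= 2 * (1 - d) ->
  d * (v n.+1 ^+ 2 + v n ^+ 2) <= 1 <= 2 * (v n.+1 ^+ 2 + v n ^+ 2).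
Proof.
move=> /andP[d0 d1]; rewrite ler_norml => /andP[y1 y2].
have : v n.+1 ^+ 2 + v n ^+ 2 - y * v n.+1 * v n = 1 := cheb_invariant y n.
move: (v n.+1) (v n) => a b E.
have h1 : 0 <= (2 * (1 - d) - y) * (a + b) ^+ 2 by rewrite mulr_ge0 ?sqr_ge0 ?subr_ge0.
have h2 : 0 <= (2 * (1 - d) + y) * (a - b) ^+ 2 by rewrite mulr_ge0 ?sqr_ge0 //; lra.
have h3 : 0 <= (2 * (1 - d) + y) * (a + b) ^+ 2 by rewrite mulr_ge0 ?sqr_ge0 //; lra.
have h4 : 0 <= (2 * (1 - d) - y) * (a - b) ^+ 2 by rewrite mulr_ge0 ?sqr_ge0 ?subr_ge0.
have h5 : 0 <= d * (a ^+ 2 + b ^+ 2) by rewrite mulr_ge0 ?addr_ge0 ?sqr_ge0 // ltW.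
by apply/andP; split; nra.
Qed.

(* Truncating a solution of [jacobi v = y v] at [N] only creates errors at the
   sites [N] and [N + 1]. *)
Lemma cheb_trunc_defect (x y : R) N M
    (v := fun n => (cheb R n).[y]) (w := trunc N.+1 v) :
  \sum_(n < M) (jacobi w n - x * w n) ^+ 2 <=
  2 * (y - x) ^+ 2 * (\sum_(n < N.+1) v n ^+ 2) + 2 * (v N.+1 ^+ 2 + v N ^+ 2).
Proof.
pose e n := (jacobi w n - x * w n) ^+ 2.
have Jv n : jacobi v n = y * v n.
  have := congr1 (horner^~ y) (jacobi_cheb R n).
  rewrite /= hornerM hornerX => <-; rewrite /jacobi hornerD /v.
  by case: n => [|n]; rewrite ?horner0.
apply: (@le_trans _ _ (\sum_(n < M + N.+2) e n)).
  by rewrite big_split_ord /= lerDl sumr_ge0 // => i _; exact: sqr_ge0.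
rewrite addnC big_split_ord /= [X in _ + X]big1 ?addr0; last first.
  move=> i _; rewrite !addSn /e /jacobi /w /trunc.
  by rewrite !ifF ?mulr0 ?subr0 ?addr0 ?expr0n //; apply/negbTE; lia.
rewrite !big_ord_recr /= -addrA.
have wE n : (n <= N)%N -> w n = v n by rewrite /w /trunc ltnS => ->.
have w0 n : (N < n)%N -> w n = 0 by move=> Nn; rewrite /w /trunc ltnS leqNgt Nn.
have small (n : nat) : (n < N)%N -> e n = (y - x) ^+ 2 * v n ^+ 2.
  move=> nN; have jE : jacobi w n = jacobi v n.
    rewrite /jacobi wE //; case: (n) nN => [|k] kN //.
    by rewrite wE // ltnW // ltnW.
  by rewrite /e jE Jv wE; [ring|exact: ltnW].
have eN : e N = ((y - x) * v N - v N.+1) ^+ 2.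
  rewrite /e wE // (_ : jacobi w N = jacobi v N - v N.+1); first by rewrite Jv; ring.
  rewrite /jacobi w0 // add0r addrAC subrr add0r.
  by case: (N) wE => [|k] wk //; rewrite wk // ltnW.
have eN1 : e N.+1 = v N ^+ 2.
  by rewrite /e /jacobi (w0 N.+2) // (w0 N.+1) // wE // mulr0 subr0 add0r.
rewrite eN eN1 (eq_bigr (fun n : 'I_N => (y - x) ^+ 2 * v n ^+ 2)) => [|n _]; last first.
  exact: small.
rewrite -mulr_sumr; have := sqsum_ge0 (fun n : 'I_N => v n).
move: (\sum_(n < N) v n ^+ 2) (v N) (v N.+1) => S a b S0.
have := sqr_ge0 ((y - x) * a + b); have := mulr_ge0 (sqr_ge0 (y - x)) S0.
have := sqr_ge0 a; nra.
Qed.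

Lemma interval_in_spectrum (x : R) : x \in `[-2, 2] -> op_spectrum A x%:C.
Proof.
rewrite in_itv /= => /andP[x1 x2] [_ [M HM]].
(* This [d] gives $|M|d \le 1/4$. As $(y-x)^2 \le 4d^2$, the interior defect then contributes at
   most half of [T N] and is absorbed; the boundary defect is at most $2/d$, whence the bound
   $4M^2/d$ in [key]. *)
pose d := (4 * (`|M| + 1))^-1; pose y := x * (1 - d).
have d0 : 0 < d by rewrite invr_gt0 mulr_gt0 // ltr_wpDl.
have d1 : d <= 1.
  by rewrite invf_le1 ?mulr_gt0 ?ltr_wpDl //; have := normr_ge0 M; lra.
have dM : (M * d) ^+ 2 <= 16^-1.
  have Md : `|M * d| <= 4^-1.
    rewrite normrM [`|d|]gtr0_norm // /d invfM mulrCA ger_pMr ?invr_gt0 //.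
    by rewrite ler_pdivrMr ?ltr_wpDl // mul1r lerDl.
  rewrite -real_normK ?num_real // (_ : 16^-1 = 4^-1 ^+ 2) ?ler_sqr ?nnegrE //.
  by field.
have y2 : `|y| <= 2 * (1 - d).
  rewrite /y normrM; apply: ler_pM => //; first by rewrite ler_norml x1.
  by rewrite ger0_norm // subr_ge0.
pose v n := (cheb R n).[y].
have d01 : 0 < d <= 1 by rewrite d0 d1.
have bd n := cheb_consecutive_bounds n d01 y2.
pose T N := \sum_(n < N.+1) v n ^+ 2.
have key N : T N <= 4 * M ^+ 2 / d.
  pose w n : R[i] := (trunc N.+1 v n)%:C.
  pose f := spread w : antitree s -> R[i].
  have sqw n : sqmod (w n) = trunc N.+1 v n ^+ 2 by rewrite sqmod_real.
  have f2 : ell2 f.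
    apply/ell2_spread => //; exists (T N) => K.
    apply: le_trans (sqmod_sum_nd w (leq_addl N.+1 K)) _.
    rewrite big_split_ord /= [X in _ + X]big1 ?addr0 => [|i _].
      by apply: ler_sum => i _; rewrite sqw /trunc ltn_ord.
    by rewrite sqw /trunc ltnNge leq_addr expr0n.
  have Tf : T N <= ell2_norm f ^+ 2.
    apply: le_trans (ball_sum_le_norm N.+1 f2); rewrite ball_sum_spread //.
    by apply: ler_sum => i _; rewrite sqw /trunc ltn_ord.
  have T0 : 0 <= T N by exact: sqsum_ge0.
  pose B := 2 * (y - x) ^+ 2 * T N + 2 * (v N.+1 ^+ 2 + v N ^+ 2).
  have B0 : 0 <= B.
    apply: addr_ge0; apply: mulr_ge0 => //; last by rewrite addr_ge0 ?sqr_ge0.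
    by rewrite mulr_ge0 ?sqr_ge0.
  have FB : ell2_norm (shift_op A x%:C f) <= Num.sqrt B.
    apply: ell2_norm_le => [|K]; first exact: sqrtr_ge0.
    rewrite sqr_sqrtr //.
    have -> : shift_op A x%:C f =
        spread (fun n => (jacobi (trunc N.+1 v) n - x * trunc N.+1 v n)%:C).
      apply/funext => p; rewrite /shift_op adjacency_spread // /f /spread mulrCA -mulrBr.
      congr (_ * _); rewrite rmorphB rmorphM /=; congr (_ - _).
      by rewrite /jacobi rmorphD /=; case: (tag p).
    rewrite ball_sum_spread //; under eq_bigr do rewrite sqmod_real.
    exact: cheb_trunc_defect.
  have fB : ell2_norm f ^+ 2 <= M ^+ 2 * B.
    have f0 := ell2_norm_ge0 f; have F0 := ell2_norm_ge0 (shift_op A x%:C f).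
    have fM := HM _ f2.
    have -> : M ^+ 2 * B = (`|M| * Num.sqrt B) ^+ 2.
      by rewrite exprMn sqr_sqrtr // real_normK ?num_real.
    rewrite ler_sqr ?nnegrE ?mulr_ge0 ?sqrtr_ge0 //.
    apply: le_trans fM _; apply: (@le_trans _ _ (`|M| * ell2_norm (shift_op A x%:C f))).
      by rewrite ler_wpM2r // ler_norm.
    by rewrite ler_wpM2l.
  have /andP[bd1 _] := bd N.
  have b1 : v N.+1 ^+ 2 + v N ^+ 2 <= d^-1.
    by rewrite -(ler_pM2l d0) mulfV ?gt_eqF.
  have xd : (y - x) ^+ 2 <= 4 * d ^+ 2.
    have -> : (y - x) ^+ 2 = x ^+ 2 * d ^+ 2 by rewrite /y; ring.
    by rewrite ler_wpM2r ?sqr_ge0 //; nra.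
  have MT : M ^+ 2 * (2 * (y - x) ^+ 2 * T N) <= T N / 2.
    have -> : M ^+ 2 * (2 * (y - x) ^+ 2 * T N) = 2 * (M ^+ 2 * (y - x) ^+ 2) * T N by ring.
    rewrite mulrC ler_wpM2l //.
    have := ler_wpM2l (sqr_ge0 M) xd; rewrite exprMn in dM; lra.
  have MV := ler_wpM2l (sqr_ge0 M) b1.
  have := le_trans Tf fB; rewrite /B mulrDr -mulrA; lra.
have lb N : N%:R / 4 <= T N.
  have : N%:R / 2 <= \sum_(n < N) (v n.+1 ^+ 2 + v n ^+ 2).
    rewrite -[N in N%:R]card_ord mulr_natl -sumr_const; apply: ler_sum => i _.
    by have /andP[_] := bd i; rewrite -/(v _) -/(v _); lra.
  rewrite big_split /= => H.
  have : \sum_(n < N) v n.+1 ^+ 2 <= T N.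
    by rewrite /T big_ord_recl /= lerDr sqr_ge0.
  have : \sum_(n < N) v n ^+ 2 <= T N.
    by rewrite /T big_ord_recr /= lerDl sqr_ge0.
  lra.
have B0 : 0 <= 16 * M ^+ 2 / d.
  by apply: divr_ge0; [rewrite mulr_ge0 ?sqr_ge0|exact: ltW].
have := archi_boundP B0; have := lb (Num.bound (16 * M ^+ 2 / d)).
have := key (Num.bound (16 * M ^+ 2 / d)).
lra.
Qed.
End IntervalInSpectrum.

(** * The eigenvalue [0] *)

Section ZeroEigenspace.
Variables (R : realType) (s : nat -> nat).
Hypothesis s_gt0 : forall n, (0 < s n)%N.
Notation V := (antitree s).
Notation A := (@adjacency_op R s).
Implicit Types (f : V -> R[i]).

Lemma radial_eq0 f n : radial f n = 0 <-> \sum_(i < s n) f (vertex i) = 0.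
Proof.
rewrite /radial; split => [/eqP|->]; last by rewrite mulr0.
rewrite mulf_eq0 => /orP[|/eqP //].
by rewrite eq_complex /= eqxx andbT invr_eq0 (negbTE (sqrt_s_neq0 R s_gt0 n)).
Qed.

Lemma eigenspace0P f : op_eigenspace A 0 f <->
  ell2 f /\ forall n, \sum_(i < s n) f (vertex i) = 0.
Proof.
split=> -[f2 H]; split => //.
  by move=> n; apply/radial_eq0; exact: eigen_radial H n.
by move=> x; rewrite mul0r adjacency_radial0 // => n; apply/radial_eq0.
Qed.

Definition base n : 'I_(s n) := Ordinal (s_gt0 n).

Lemma vertex_inj n : injective (@vertex s n).
Proof.
by move=> i j E; apply/eqP; have := eqxx (vertex i); rewrite {1}E eq_sym eq_Tagged.
Qed.

Definition delta (y x : V) : R[i] := (x == y)%:R.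

Lemma ell2_delta y : ell2 (delta y).
Proof.
apply/ell2P; exists 1 => N; rewrite /ball_sum -big_ball_seq.
have [yN|yN] := boolP (y \in ball_seq s N).
  rewrite (bigD1_seq y) ?ball_seq_uniq //= big1 ?addr0 => [|x /negbTE xy].
    by rewrite /delta eqxx sqmod_real expr1n.
  by rewrite /delta xy sqmod_real expr0n.
rewrite big1_seq // => x /= xN; rewrite /delta.
by case: eqP xN yN => [-> -> //|_ _ _]; rewrite sqmod_real expr0n.
Qed.

Lemma sum_delta n (i : 'I_(s n)) m :
  \sum_(j < s m) delta (vertex i) (vertex j) = (m == n)%:R.
Proof.
rewrite /delta; case: eqP => [mn|mn]; last first.
  by rewrite big1 // => j _; case: eqP => // /(congr1 tag).
subst m; rewrite (bigD1 i) //= eqxx big1 ?addr0 // => j /negbTE ji.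
by rewrite (inj_eq (@vertex_inj n)) ji.
Qed.

Definition dipole n (i : 'I_(s n)) (x : V) : R[i] :=
  delta (vertex i) x + (-1) * delta (vertex (base n)) x.

Lemma eigenspace_dipole n (i : 'I_(s n)) : op_eigenspace A 0 (dipole i).
Proof.
apply/eigenspace0P; split; first by apply: ell2_lincomb; exact: ell2_delta.
by move=> m; rewrite big_split /= -mulr_sumr !sum_delta mulN1r subrr.
Qed.

(* Elements of the zero eigenspace sum to zero on each shell, hence are determined
   by their values off the base vertices. *)
Definition offbase N : finType :=
  {n : 'I_N & {i : 'I_(s n) | i != base n}}.

Definition offbase_vertex N (p : offbase N) : V := vertex (val (tagged p)).

Lemma card_offbase N : #|offbase N| = (\sum_(n < N) (s n - 1))%N.
Proof.
rewrite card_tagged sumnE big_map big_enum; apply: eq_bigr => n _.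
by rewrite card_sig cardC1 card_ord subn1.
Qed.

Lemma offbase_vertex_inj N : injective (@offbase_vertex N).
Proof.
move=> [n [i ib]] [m [j jb]]; rewrite /offbase_vertex /= => E.
have nm : n = m by apply/val_inj; exact: (congr1 tag E).
subst m; have ij : i = j by exact: vertex_inj E.
by subst j; rewrite (bool_irrelevance ib jb).
Qed.

Lemma dipole_offbase N (p q : offbase N) :
  dipole (val (tagged p)) (offbase_vertex q) = (p == q)%:R.
Proof.
rewrite /dipole /delta -[vertex (val (tagged p))]/(offbase_vertex p).
rewrite (inj_eq (@offbase_vertex_inj N)) eq_sym.
suff /negbTE -> : offbase_vertex q != vertex (base (tag p)) by rewrite mulr0 addr0.
apply/eqP; case: p q => [n [i ib]] [m [j jb]]; rewrite /offbase_vertex /= => E.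
have nm : m = n by apply/val_inj; exact: (congr1 tag E).
by subst m; move: jb; rewrite (vertex_inj E) eqxx.
Qed.

Notation m := ((\sum_(0 <= n <oo) ((s n - 1)%N%:R)%:E)%E : \bar R).

Lemma partial_sum_le_series N : ((\sum_(n < N) (s n - 1))%N%:R%:E <= m)%E.
Proof.
rewrite -(big_mkord predT (fun n => (s n - 1)%N)) natr_sum -sumEFin.
by apply: nneseries_lim_ge => n _ _; rewrite lee_fin ler0n.
Qed.

Lemma series_le (C : \bar R) :
  (forall N, ((\sum_(n < N) (s n - 1))%N%:R%:E <= C)%E) -> (m <= C)%E.
Proof.
move=> HC; apply: lime_le; first by apply: is_cvg_nneseries => n _ _; rewrite lee_fin ler0n.
apply: nearW => N; have := HC N.
by rewrite -(big_mkord predT (fun n => (s n - 1)%N)) natr_sum -sumEFin.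
Qed.

(** Evaluating the dipoles at the off-base vertices gives an identity matrix, so they are
    independent. *)
Lemma eigenspace0_dim_ge : (m <= subspace_dim (op_eigenspace A 0%R))%E.
Proof.
apply: series_le => N; rewrite -card_offbase; apply: ereal_sup_ubound => /=.
exists #|offbase N| => //=.
exists (fun k => dipole (val (tagged (enum_val k)))); split.
  by move=> k; exact: eigenspace_dipole.
move=> c c0 k; have := c0 (offbase_vertex (enum_val k)).
rewrite (bigD1 k) //= dipole_offbase eqxx mulr1 big1 ?addr0 // => j jk.
by rewrite dipole_offbase (inj_eq enum_val_inj) (negbTE jk) mulr0.
Qed.

(** More independent vectors than [m] would make [m] finite, so all but finitely many shells are
    singletons. Evaluation at the finitely many off-base vertices is then injective on the
    eigenspace, but has a kernel on the span of the vectors for dimension reasons. *)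
Lemma eigenspace0_dim_le : (subspace_dim (op_eigenspace A 0%R) <= m)%E.
Proof.
apply: ub_ereal_sup => _ [n [e [eW ind]] <-]; rewrite leNgt; apply/negP => mn.
pose K N := (\sum_(n < N) (s n - 1))%N.
have Kn N : (K N < n)%N.
  by rewrite -(ltr_nat R) -lte_fin; exact: le_lt_trans (partial_sum_le_series N) mn.
(* The partial sums are integers bounded by [n], so they attain a maximum; past it no shell has a
   second vertex. *)
have [N Nmax] : exists N, forall N', (K N' <= K N)%N.
  have ex : exists k, `[< exists N, K N = k >] by exists (K 0); apply/asboolP; exists 0%N.
  have ub k : `[< exists N, K N = k >] -> (k <= n)%N by move=> /asboolP[N <-]; exact: ltnW.
  case: (ex_maxnP ex ub) => k /asboolP[N <-] max; exists N => N'.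
  by apply: max; apply/asboolP; exists N'.
have s1 k : (N <= k)%N -> s k = 1%N.
  move=> Nk; have := Nmax k.+1; rewrite {1}/K big_ord_recr /= -/(K k).
  have : (K N <= K k)%N by rewrite -(subnKC Nk) /K big_split_ord leq_addr.
  have := s_gt0 k; lia.
pose M : 'M[R[i]]_(n, #|offbase N|) := \matrix_(i, p) e i (offbase_vertex (enum_val p)).
have : kermx M != 0.
  rewrite -mxrank_eq0 mxrank_ker subn_eq0 -ltnNge.
  by apply: leq_ltn_trans (rank_leq_col M) _; rewrite card_offbase; exact: Kn.
move=> /rowV0Pn[c /sub_kermxP cM c0].
pose f x := \sum_(i < n) c 0 i * e i x.
have f_shell k : \sum_(j < s k) f (vertex j) = 0.
  rewrite /f exchange_big /= big1 // => i _; rewrite -mulr_sumr.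
  by have [_ ->] := (eigenspace0P _).1 (eW i); rewrite mulr0.
have f_off (p : offbase N) : f (offbase_vertex p) = 0.
  have := congr1 (fun B : 'rV_ _ => B 0 (enum_rank p)) cM; rewrite !mxE => E.
  rewrite /f -[RHS]E; apply: eq_bigr => i _; by rewrite mxE enum_rankK.
have f_nb k (j : 'I_(s k)) : j != base k -> f (vertex j) = 0.
  move=> jb; have [kN|Nk] := ltnP k N; last first.
    exfalso; move/negP: jb; apply; apply/eqP/val_inj => /=.
    by have := ltn_ord j; rewrite {2}(s1 k Nk); case: (val j).
  exact: (f_off (existT (fun n : 'I_N => {i : 'I_(s n) | i != base n}) (Ordinal kN) (exist _ j jb))).
have f0 x : f x = 0.
  rewrite -(vertexE x); move: (tag x) (tagged x) => k j.
  have [->|] := eqVneq j (base k); last exact: f_nb.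
  have := f_shell k; rewrite (bigD1 (base k)) //= big1 ?addr0 // => i; exact: f_nb.
move/negP: c0; apply; apply/eqP/rowP => i; rewrite mxE; exact: (ind _ f0).
Qed.

Lemma eigenspace0_dim : subspace_dim (op_eigenspace A 0) = m.
Proof. by apply/eqP; rewrite eq_le eigenspace0_dim_le eigenspace0_dim_ge. Qed.

Lemma eigenvalueP z : op_eigenvalue A z <-> z = 0 /\ m <> 0%E.
Proof.
split=> [[f [f2 Af] [x fx]]|[-> m0]].
  have z0 : z = 0.
    apply/eqP; apply: contraT => z0; move/negP: fx; case; apply/eqP.
    exact: eigen_nonzero z0 f2 Af x.
  split => // m0; have [_ /(_ (tag x)) fs] := (eigenspace0P f).1
    (conj f2 (eq_ind z (fun z => forall x, A f x = z * f x) Af 0 z0)).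
  have [s2|s1] := ltnP 1 (s (tag x)).
    have := partial_sum_le_series (tag x).+1; rewrite m0 lee_fin big_ord_recr /= natrD.
    apply/negP; rewrite -ltNge ltr_wpDl ?ler0n // ltr0n; lia.
  move/negP: fx; case; apply/eqP; rewrite -[RHS]fs (bigD1 (tagged x)) //= vertexE.
  rewrite big1 ?addr0 // => j /negP[]; apply/eqP/val_inj.
  by have := ltn_ord j; have := ltn_ord (tagged x); rewrite /=; lia.
have [n s2] : exists n, (1 < s n)%N.
  apply: contrapT => nex; apply: m0; apply/eqP; rewrite eq_le; apply/andP; split.
    apply: series_le => N; rewrite big1 // => n _; have [s2|] := ltnP 1 (s n); last by lia.
    by exfalso; apply: nex; exists n.
  by apply: nneseries_ge0 => n _ _; rewrite lee_fin ler0n.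
exists (dipole (Ordinal s2)); first exact: eigenspace_dipole.
exists (vertex (Ordinal s2)); rewrite /dipole /delta eqxx (inj_eq (@vertex_inj n)).
by rewrite -(inj_eq val_inj) /= mulr0 addr0 oner_eq0.
Qed.

(** Orthogonality to the dipoles alone forces [f] to be constant on each shell. *)
Lemma orthocomp_spread f : ell2_orthocomp (op_eigenspace A 0) f ->
  f = spread (radial f).
Proof.
move=> [f2 fperp].
have fc n (i : 'I_(s n)) : f (vertex i) = f (vertex (base n)).
  have := fperp _ (eigenspace_dipole i); rewrite /ell2_inner /csum.
  pose d x : R := (x == vertex i)%:R - (x == vertex (base n))%:R.
  have dE x : dipole i x = (d x)%:C.
    by rewrite /dipole /delta /d rmorphB /= !rmorph_nat mulN1r.
  have d_sum (h : V -> R) : rsum (fun x => d x * h x) = h (vertex i) - h (vertex (base n)).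
    have mem j : vertex (n := n) j \in ball_seq s n.+1 by rewrite mem_ball_seq /=.
    have pick j : \sum_(x <- ball_seq s n.+1) (x == vertex (n := n) j)%:R * h x = h (vertex j).
      rewrite (bigD1_seq (vertex j)) ?ball_seq_uniq //= eqxx mul1r big1 ?addr0 //.
      by move=> x /negbTE ->; rewrite mul0r.
    rewrite (@rsum_finsupp _ _ _ n.+1) => [|x nx].
      rewrite /ball_sum -(big_ball_seq (fun x => d x * h x)) -[X in X - _]pick -[X in _ - X]pick -sumrB.
      by apply: eq_bigr => x _; rewrite mulrBl.
    have nv j : (x == vertex (n := n) j) = false.
      by apply/negbTE; apply: contraTneq nx => ->; rewrite /= ltnn.
    by rewrite /d !nv subrr mul0r.
  have -> : (fun x => complex.Re ((dipole i x)^* * f x)) = (fun x => d x * complex.Re (f x)).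
    by apply/funext => x; rewrite dE; case: (f x) => p q /=; ring.
  have -> : (fun x => complex.Im ((dipole i x)^* * f x)) = (fun x => d x * complex.Im (f x)).
    by apply/funext => x; rewrite dE; case: (f x) => p q /=; ring.
  rewrite !d_sum => /eqP; rewrite eq_complex /= !subr_eq0 => /andP[/eqP E1 /eqP E2].
  by apply/eqP; rewrite eq_complex E1 E2 !eqxx.
apply/funext => x; rewrite -(vertexE x); move: (tag x) (tagged x) => n i.
rewrite /spread /radial /=; under eq_bigr do rewrite fc.
rewrite fc mulr_sumr sum_spread_const // mulrA -rmorphM /= mulVf ?mul1r //.
exact: sqrt_s_neq0.
Qed.
End ZeroEigenspace.

(** * Absolute continuity *)

Section DensityMeasure.
Variables (R : realType) (d : measurableTypeR R -> R).
Notation mu := (@lebesgue_measure R).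
Hypotheses (d_ge0 : forall x, 0 <= d x) (intd : mu.-integrable setT (EFin \o d)).

(* The two proofs are arguments so that the finite measure structure below can be
   inferred. *)
Definition density_measure of (forall x, 0 <= d x) & mu.-integrable setT (EFin \o d) :=
  fun S : set (measurableTypeR R) => (\int[mu]_(x in S) (d x)%:E)%E.

Local Notation nu := (density_measure d_ge0 intd).

Let md : measurable_fun setT (EFin \o d).
Proof. exact: measurable_int intd. Qed.

Let nu0 : nu set0 = 0%E. Proof. by rewrite /density_measure integral_set0. Qed.

Let nu_ge0 S : (0 <= nu S)%E.
Proof. by apply: integral_ge0 => x _; rewrite lee_fin. Qed.

Let nu_sigma_additive : semi_sigma_additive nu.
Proof. by apply: semi_sigma_additive_nng_induced => // x; rewrite lee_fin. Qed.

HB.instance Definition _ := isMeasure.Build _ _ _ nu nu0 nu_ge0 nu_sigma_additive.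

Let nu_fin : fin_num_fun nu.
Proof.
move=> S mS; apply: integrable_fin_num => //; exact: integrableS intd.
Qed.

HB.instance Definition _ := @Measure_isFinite.Build _ _ _ nu nu_fin.

Lemma density_measure_dominates : nu `<< mu.
Proof.
apply/null_content_dominatesP => S mS S0.
apply: null_set_integral => //; exact: measurable_funTS.
Qed.

(** Change of variables holds with the Radon-Nikodym derivative, which agrees with [d] almost
    everywhere because both have the same integrals over measurable sets. *)
Lemma ge0_integral_density (f : measurableTypeR R -> \bar R) :
  (forall x, 0 <= f x)%E -> measurable_fun setT f ->
  (\int[nu]_x f x = \int[mu]_x (f x * (d x)%:E))%E.
Proof.
move=> f0 mf.
rewrite -(Radon_Nikodym_SigmaFinite.change_of_variables density_measure_dominates) //.
apply: ae_eq_integral => //.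
- apply: emeasurable_funM => //; apply: measurable_int.
  exact: Radon_Nikodym_SigmaFinite.f_integrable density_measure_dominates.
- exact: emeasurable_funM.
- apply: ae_eqe_mul2l; apply: integral_ae_eq => //.
    exact: Radon_Nikodym_SigmaFinite.f_integrable density_measure_dominates.
  move=> E _ mE.
  by rewrite -(Radon_Nikodym_SigmaFinite.f_integral density_measure_dominates).
Qed.

Lemma Rintegral_density (f : measurableTypeR R -> R) : measurable_fun setT f ->
  \int[nu]_x f x = \int[mu]_x (f x * d x).
Proof.
move=> mf; rewrite /Rintegral integralE [in RHS]integralE.
have mEf : measurable_fun setT (EFin \o f) by exact/measurable_EFinP.
rewrite !ge0_integral_density //; [|exact: measurable_funeneg|exact: measurable_funepos].
congr (fine (_ - _)%E); apply: eq_integral => x _; rewrite ?funeposE ?funenegE /=.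
  by rewrite -!EFin_max -EFinM maxr_pMl // mul0r.
by rewrite -!EFin_max -EFinM maxr_pMl // mul0r mulNr.
Qed.
End DensityMeasure.

(** * Spectral measures of radial vectors *)

Section SpectralMeasure.
Variables (R : realType) (s : nat -> nat).
Hypothesis s_gt0 : forall n, (0 < s n)%N.
Notation V := (antitree s).
Notation A := (@adjacency_op R s).
Notation mu := (@lebesgue_measure R).
Implicit Types (u v w : nat -> R[i]).
Let re u n : R := complex.Re (u n).
Let im u n : R := complex.Im (u n).

Lemma cvg_sum_ord m (F : nat -> nat -> R) (l : nat -> R) :
  (forall k, F k N @[N --> \oo] --> l k) ->
  \sum_(k < m) F k N @[N --> \oo] --> \sum_(k < m) l k.
Proof.
move=> Fl; elim: m => [|m IH].
  by rewrite big_ord0; under eq_fun do rewrite big_ord0; exact: cvg_cst.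
rewrite big_ord_recr /=; under eq_fun do rewrite big_ord_recr /=.
exact: cvgD IH (Fl m).
Qed.

Lemma sqsummable_re u : csqsummable u -> sqsummable (re u).
Proof.
move=> [C uC]; exists C => N; apply: le_trans (uC N).
by apply: ler_sum => n _; rewrite /sqmod lerDl sqr_ge0.
Qed.

Lemma sqsummable_im u : csqsummable u -> sqsummable (im u).
Proof.
move=> [C uC]; exists C => N; apply: le_trans (uC N).
by apply: ler_sum => n _; rewrite /sqmod lerDr sqr_ge0.
Qed.

Lemma re_iter_jacobi u k n : complex.Re (iter k jacobi u n) = iter k jacobi (re u) n.
Proof.
elim: k n => //= k IH n; rewrite {1}/jacobi /= raddfD /= IH /jacobi.
by case: n => // n; rewrite IH.
Qed.

Lemma im_iter_jacobi u k n : complex.Im (iter k jacobi u n) = iter k jacobi (im u) n.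
Proof.
elim: k n => //= k IH n; rewrite {1}/jacobi /= raddfD /= IH /jacobi.
by case: n => // n; rewrite IH.
Qed.

Lemma csqsummable_lincomb u v (c : R[i]) : csqsummable u -> csqsummable v ->
  csqsummable (fun n => u n + c * v n).
Proof.
move=> [C uC] [D vD]; exists (2 * C + 2 * (sqmod c * D)) => N.
apply: (@le_trans _ _ (2 * \sum_(n < N) sqmod (u n) + 2 * (sqmod c * \sum_(n < N) sqmod (v n)))).
  rewrite !mulr_sumr -big_split /=; apply: ler_sum => n _.
  by apply: le_trans (sqmodD_le _ _) _; rewrite sqmodM.
apply: lerD; rewrite ler_pM2l //.
by apply: ler_wpM2l => //; exact: sqmod_ge0.
Qed.

Lemma csqsummable_iter_jacobi u k : csqsummable u -> csqsummable (iter k jacobi u).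
Proof. by move=> su; elim: k => //= k; exact: csqsummable_jacobi. Qed.

Lemma csqsummable_poly u (p : {poly R}) : csqsummable u ->
  csqsummable (fun n => \sum_(k < size p) (p`_k)%:C * iter k jacobi u n).
Proof.
move=> su; elim: (size p) => [|m IH].
  by exists 0 => N; rewrite big1 // => n _; rewrite big_ord0 sqmod_real expr0n.
have := csqsummable_lincomb (p`_m)%:C IH (csqsummable_iter_jacobi m su).
by congr csqsummable; apply/funext => n; rewrite big_ord_recr.
Qed.

Lemma poly_op_spread u (p : {poly R}) :
  poly_op A p (spread u) =
  spread (fun n => \sum_(k < size p) (p`_k)%:C * iter k jacobi u n).
Proof.
apply/funext => x; rewrite /poly_op /spread mulr_sumr; apply: eq_bigr => k _.
by rewrite iter_adjacency_spread // /spread mulrCA.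
Qed.

Lemma ball_sum_radial (h : nat -> R) N :
  ball_sum (fun x : V => (s (tag x))%:R^-1 * h (tag x)) N = \sum_(n < N) h n.
Proof.
apply: eq_bigr => n _; rewrite /= sumr_const card_ord -[LHS]mulr_natl mulrA.
by rewrite mulfV ?mul1r // pnatr_eq0 -lt0n.
Qed.

(** [spread] preserves inner products. Boundedness of $|u_n|^2 + |w_n|^2$ in the sum gives the
    absolute summability under which the unordered sums are limits over balls. *)
Lemma ell2_inner_spread u w (l1 l2 : R) : csqsummable u -> csqsummable w ->
  \sum_(n < N) (re u n * re w n + im u n * im w n) @[N --> \oo] --> l1 ->
  \sum_(n < N) (re u n * im w n - im u n * re w n) @[N --> \oo] --> l2 ->
  ell2_inner (spread u : V -> R[i]) (spread w) = l1 +i* l2.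
Proof.
move=> [C uC] [D wD] cl1 cl2.
have rad (h : nat -> R) (l : R) : (forall n, `|h n| <= sqmod (u n) + sqmod (w n)) ->
    \sum_(n < N) h n @[N --> \oo] --> l ->
    rsum (fun x : V => (s (tag x))%:R^-1 * h (tag x)) = l.
  move=> hb hl; have bd N : ball_sum (fun x : V => `|(s (tag x))%:R^-1 * h (tag x)|) N <= C + D.
    have -> : (fun x : V => `|(s (tag x))%:R^-1 * h (tag x)|) =
        (fun x : V => (s (tag x))%:R^-1 * `|h (tag x)|).
      by apply/funext => x; rewrite normrM ger0_norm // invr_ge0 ler0n.
    rewrite (ball_sum_radial (fun n => `|h n|)).
    apply: (@le_trans _ _ (\sum_(n < N) (sqmod (u n) + sqmod (w n)))).
      by apply: ler_sum => n _; exact: hb.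
    by rewrite big_split; apply: lerD; [exact: uC|exact: wD].
  have := rsum_ball bd; under [X in X @ _ --> _ -> _]eq_fun do rewrite ball_sum_radial.
  by move=> /(cvg_lim (@norm_hausdorff _ _)) <-; exact: cvg_lim hl.
have inv2 (x : V) : (Num.sqrt (s (tag x))%:R)^-1 ^+ 2 = (s (tag x))%:R^-1 :> R.
  by rewrite exprVn sqr_sqrtr // ler0n.
rewrite /ell2_inner /csum; congr (_ +i* _).
- apply: etrans (rad (fun n => re u n * re w n + im u n * im w n) l1 _ cl1) => [|n].
    congr rsum; apply/funext => x; rewrite -inv2 /spread /re /im.
    by case: (u _) (w _) => a b [c d] /=; ring.
  rewrite /re /im; case: (u n) (w n) => a b [c d]; rewrite /sqmod /= ler_norml.
  have := sqr_ge0 (a - c); have := sqr_ge0 (a + c).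
  have := sqr_ge0 (b - d); have := sqr_ge0 (b + d).
  by move=> *; apply/andP; split; nra.
- apply: etrans (rad (fun n => re u n * im w n - im u n * re w n) l2 _ cl2) => [|n].
    congr rsum; apply/funext => x; rewrite -inv2 /spread /re /im.
    by case: (u _) (w _) => a b [c d] /=; ring.
  rewrite /re /im; case: (u n) (w n) => a b [c d]; rewrite /sqmod /= ler_norml.
  have := sqr_ge0 (a - d); have := sqr_ge0 (a + d).
  have := sqr_ge0 (b - c); have := sqr_ge0 (b + c).
  by move=> *; apply/andP; split; nra.
Qed.

(* On truncated sequences the two sums agree, both being given by the symmetric
   expression of [sc_int_cheb_sum_Xn]. *)
Lemma jacobi_antisym_cvg (a b : nat -> R) k : sqsummable a -> sqsummable b ->
  (\sum_(n < N) a n * iter k jacobi b n - \sum_(n < N) b n * iter k jacobi a n)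
    @[N --> \oo] --> 0.
Proof.
move=> sa sb.
have sym N : \sum_(n < N) a n * iter k jacobi (trunc N b) n =
    \sum_(n < N) b n * iter k jacobi (trunc N a) n.
  have c0 : sc_int 1 != 0 :> R by rewrite gt_eqF // sc_int1_gt0.
  apply: (mulIf c0); rewrite -!sc_int_cheb_sum_Xn; congr sc_int; ring.
have h : ((\sum_(n < N) a n * iter k jacobi b n -
      \sum_(n < N) a n * iter k jacobi (trunc N b) n) -
    (\sum_(n < N) b n * iter k jacobi a n -
      \sum_(n < N) b n * iter k jacobi (trunc N a) n)) @[N --> \oo] --> (0 - 0 : R).
  by apply: cvgB; exact: jacobi_trunc_cvg.
rewrite subrr in h; rewrite (_ : (fun N => _ - _) = (fun N =>
    (\sum_(n < N) a n * iter k jacobi b n -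
      \sum_(n < N) a n * iter k jacobi (trunc N b) n) -
    (\sum_(n < N) b n * iter k jacobi a n -
      \sum_(n < N) b n * iter k jacobi (trunc N a) n))) //.
by apply/funext => N; rewrite sym; ring.
Qed.

Lemma Rintegral_lincomb m (c : nat -> R) (F : nat -> measurableTypeR R -> R) :
  (forall k, mu.-integrable setT (EFin \o F k)) ->
  mu.-integrable setT (EFin \o (fun x => \sum_(k < m) c k * F k x)) /\
  \int[mu]_x (\sum_(k < m) c k * F k x) = \sum_(k < m) c k * \int[mu]_x F k x.
Proof.
move=> iF; have icF k : mu.-integrable setT (EFin \o (fun x => c k * F k x)).
  have := integrableZl measurableT (c k) (iF k).
  by congr (_.-integrable _ _); apply/funext => x /=; rewrite EFinM.
elim: m => [|m [IH1 IH2]].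
  rewrite big_ord0 (_ : (fun x => _) = cst 0); last by apply/funext => x; rewrite big_ord0.
  by split; [exact: integrable0|rewrite Rintegral_cst // mul0r].
have -> : (fun x => \sum_(k < m.+1) c k * F k x) =
    (fun x => \sum_(k < m) c k * F k x + c m * F m x).
  by apply/funext => x; rewrite big_ord_recr.
split.
  have := integrableD measurableT IH1 (icF m).
  by congr (_.-integrable _ _); apply/funext => x /=; rewrite EFinD.
by rewrite RintegralD // IH2 RintegralZl // big_ord_recr.
Qed.

(** For $u = a + ib$ with $a$, $b$ real, $\langle u, J^k u\rangle$ has real part $\langle a, J^k
    a\rangle + \langle b, J^k b\rangle$ and imaginary part $\langle a, J^k b\rangle - \langle b, J^k
    a\rangle$, which vanishes by symmetry. So the densities of $a$ and $b$ add up to that of $u$. *)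
Lemma ac_subspace_spread u : csqsummable u -> ac_subspace A (spread u).
Proof.
move=> su; split; first by apply/ell2_spread.
have sa := sqsummable_re su; have sb := sqsummable_im su.
have [da [mda da0 daD ida cda]] := sc_spectral_density sa.
have [db [mdb db0 dbD idb cdb]] := sc_spectral_density sb.
pose d (x : measurableTypeR R) := da x + db x.
have d0 x : 0 <= d x by rewrite addr_ge0.
have idk k : mu.-integrable setT (fun x => (x ^+ k * d x)%:E).
  have := integrableD measurableT (ida k) (idb k).
  by congr (_.-integrable _ _); apply/funext => x /=; rewrite -EFinD mulrDr.
have id : mu.-integrable setT (EFin \o d).
  have := idk 0%N; congr (_.-integrable _ _).
  by apply/funext => x /=; rewrite expr0 mul1r.
exists (density_measure d0 id); last exact: density_measure_dominates.
split.
  (* A point off the spectrum lies outside $[-2,2]$, where both densities vanish identically. *)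
  rewrite /= /density_measure; apply: integral0_eq => x /= xs.
  have xD : (x : R) \notin `[-2, 2].
    by apply/negP => xD; apply: xs; exact: interval_in_spectrum.
  by rewrite /d daD // dbD // addr0.
move=> p; rewrite poly_op_spread.
pose W n := \sum_(k < size p) (p`_k)%:C * iter k jacobi u n.
pose I k := \int[mu]_x (x ^+ k * da x) + \int[mu]_x (x ^+ k * db x).
have -> : \int[density_measure d0 id]_x p.[x] = \sum_(k < size p) p`_k * I k.
  rewrite Rintegral_density; last first.
    by apply: continuous_measurable_fun; exact: continuous_horner.
  have [_] := Rintegral_lincomb (size p) (fun k => p`_k) idk.
  have -> : (fun x : measurableTypeR R => p.[x] * d x) =
      (fun x => \sum_(k < size p) p`_k * (x ^+ k * d x)).
    apply/funext => x; rewrite horner_coef mulr_suml.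
    by apply: eq_bigr => k _; rewrite mulrA.
  move=> ->; apply: eq_bigr => k _; congr (_ * _).
  rewrite /I -(RintegralD measurableT (ida k) (idb k)).
  by apply: eq_Rintegral => x _; rewrite /d mulrDr.
have reW n : re W n = \sum_(k < size p) p`_k * iter k jacobi (re u) n.
  rewrite /re /W raddf_sum; apply: eq_bigr => k _ /=.
  by rewrite -re_iter_jacobi; case: (iter k _ _ _) => x y /=; ring.
have imW n : im W n = \sum_(k < size p) p`_k * iter k jacobi (im u) n.
  rewrite /im /W raddf_sum; apply: eq_bigr => k _ /=.
  by rewrite -im_iter_jacobi; case: (iter k _ _ _) => x y /=; ring.
rewrite (@ell2_inner_spread u W (\sum_(k < size p) p`_k * I k) 0) //.
- exact: csqsummable_poly.
- pose F k N := p`_k * (\sum_(n < N) re u n * iter k jacobi (re u) n +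
    \sum_(n < N) im u n * iter k jacobi (im u) n).
  rewrite (_ : (fun N => _) = (fun N => \sum_(k < size p) F k N)).
    apply: (@cvg_sum_ord (size p) F (fun k => p`_k * I k)) => k.
    by apply: cvgMr; exact: cvgD (cda k) (cdb k).
  apply/funext => N; rewrite /F; under eq_bigr do rewrite reW imW.
  under [RHS]eq_bigr do rewrite -big_split mulr_sumr.
  rewrite exchange_big; apply: eq_bigr => n _ /=.
  by rewrite !mulr_sumr -big_split /=; apply: eq_bigr => k _; ring.
- pose F k N := p`_k * (\sum_(n < N) re u n * iter k jacobi (im u) n -
    \sum_(n < N) im u n * iter k jacobi (re u) n).
  rewrite (_ : (fun N => _) = (fun N => \sum_(k < size p) F k N)).
    rewrite [X in _ --> X](_ : 0 = \sum_(k < size p) p`_k * 0).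
      apply: (@cvg_sum_ord (size p) F (fun k => p`_k * 0)) => k.
      by apply: cvgMr; exact: jacobi_antisym_cvg.
    by rewrite big1 // => k _; rewrite mulr0.
  apply/funext => N; rewrite /F; under eq_bigr do rewrite reW imW.
  under [RHS]eq_bigr do rewrite -sumrB mulr_sumr.
  rewrite exchange_big; apply: eq_bigr => n _ /=.
  by rewrite !mulr_sumr -sumrB; apply: eq_bigr => k _; ring.
Qed.
End SpectralMeasure.

Theorem proposition1p1 (R : realType) (s : nat -> nat)
    (s_gt0 : forall n, (0 < s n)%N) :
  let A := @adjacency_op R s in
  let m : \bar R := (\sum_(0 <= n <oo) ((s n - 1)%N%:R)%:E)%E in
  [/\ op_spectrum A = [set x%:C | x in `[-2, 2]],
      ell2_orthocomp (op_eigenspace A 0) `<=` ac_subspace A,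
      subspace_dim (op_eigenspace A 0) = m &
      forall z : R[i], op_eigenvalue A z <-> z = 0 /\ m <> 0%E].
Proof.
move=> A m; split.
- apply/seteqP; split => z /=.
    move=> nz; apply: contrapT => nzx; apply: nz; apply: resolvent_off_interval => //.
    by move=> x x2 zx; apply: nzx; exists x.
  by move=> [x x2 <-]; exact: interval_in_spectrum.
- move=> psi psi_perp; have [psi2 _] := psi_perp.
  rewrite (orthocomp_spread s_gt0 psi_perp).
  by apply: ac_subspace_spread => //; exact: csqsummable_radial.
- exact: eigenspace0_dim.
- exact: eigenvalueP.
Qed.
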